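(* Let $G$ be a non-discrete LCA group with dual $\Gamma$, $V$ an open neighbourhood of $0\in\Gamma$ with compact closure $\bar V$, and let $(\mathcal S,\|\cdot\|_{\mathcal S})$ be a Segal algebra in $(\mathcal A(\Gamma),\|\cdot\|^{\bar V})$. Then (i) $\mathbb M(\mathcal S)\supseteq C^{\bar V}_{BSE}(\Gamma)$; (ii) if $\mathcal S$ is isometrically translation invariant, then $\mathbb M(\mathcal S)=C^{\bar V}_{BSE}(\Gamma)$.
   Context: $G$ non-discrete LCA with dual $\Gamma$, $(x,\gamma)=\gamma(x)$. For $E\subseteq\Gamma$, $\mathrm{span}(E)$ is the span of the characters in $E$ as functions on $G$, each $p=\sum\hat p(\gamma)\gamma$ uniquely, $\|p\|_\infty=\sup_G|p|$. For $\phi\in C_b(\Gamma)$: $\|\phi\|^{\bar V,\gamma}=\sup\{|\sum_{\gamma'\in\bar V+\gamma}\hat p(\gamma')\phi(\gamma')|:p\in\mathrm{span}(\bar V+\gamma),\|p\|_\infty\le1\}$, $\|\phi\|^{\bar V}=\sup_\gamma\|\phi\|^{\bar V,\gamma}$, $C^{\bar V}_{BSE}(\Gamma)=\{\phi\in C_b(\Gamma):\|\phi\|^{\bar V}<\infty\}$. With $\mathcal K(\Gamma)$ the compact subsets of $\Gamma$ with dense nonempty interior directed by inclusion, $\mathcal A(\Gamma)=\{\psi\in C^{\bar V}_{BSE}(\Gamma):\lim_{\Omega\in\mathcal K(\Gamma)}\sup_{\gamma\notin\Omega}\|\psi\|^{\bar V,\gamma}=0\}$, a commutative Banach function algebra under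 pointwise operations and $\|\cdot\|^{\bar V}$. A Segal algebra in $\mathcal A(\Gamma)$ is a dense ideal $\mathcal S$ that is a Banach space under a norm $\|\cdot\|_{\mathcal S}\ge\|\cdot\|^{\bar V}$, with $\|\phi\psi\|_{\mathcal S}\le\|\phi\|_{\mathcal S}\|\psi\|^{\bar V}$ ($\phi\in\mathcal S,\psi\in\mathcal A(\Gamma)$), and having approximate units (for each $\phi\in\mathcal S$, $\varepsilon>0$ some $u\in\mathcal S$ has $\|\phi-u\phi\|_{\mathcal S}<\varepsilon$). It is isometrically translation invariant if $\psi\in\mathcal S$ implies $\psi(\cdot-\gamma)\in\mathcal S$ with the same norm for every $\gamma\in\Gamma$. $\mathbb M(\mathcal S)=\{\phi\in C_b(\Gamma):\phi\psi\in\mathcal S\ \forall\psi\in\mathcal S\}$ (the multiplier algebra, identified with functions on $\Gamma$), with operator norm $\|\phi\|_{\mathbb M(\mathcal S)}$. *)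

(* Defs.v *)
From HB Require Import structures.
From mathcomp Require Import all_boot all_order all_algebra.
From mathcomp Require Import all_classical all_reals all_analysis.
From mathcomp Require Import complex.
Import numFieldTopology.Exports numFieldNormedType.Exports.
Import Order.TTheory GRing.Theory Num.Theory.

Set Implicit Arguments.
Unset Strict Implicit.
Unset Printing Implicit Defensive.

Local Open Scope classical_set_scope.
Local Open Scope ring_scope.

Definition CC (R : realType) : numClosedFieldType := R[i].

Definition cabs {R : realType} (z : CC R) : R := @ComplexField.Normc.normc R z.

Definition LCA_group (G : topologicalZmodType) : Prop :=
  hausdorff_space G /\ locally_compact [set: G].

Definition non_discrete (G : topologicalZmodType) : Prop :=
  ~ (forall x : G, open [set x]).

Section Dual.
Context {R : realType} {G : topologicalZmodType}.
Local Notation C := (CC R).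

Definition is_character (f : G -> C) : Prop :=
  [/\ continuous f, (forall x, `|f x| = 1) & (forall x y, f (x + y) = f x * f y)].

Record character := Character { chf :> G -> C ; chP : is_character chf }.

HB.instance Definition _ := gen_eqMixin character.
HB.instance Definition _ := gen_choiceMixin character.

Definition dual : Type :=
  initial_topology (fun g : character => (chf g : {compact-open, G -> C})).

Lemma ch0_subproof : is_character (fun _ : G => 1 : C).
Proof.
split; first exact: cst_continuous.
- by move=> _; rewrite normr1.
- by move=> _ _; rewrite mulr1.
Qed.

Definition ch0 : dual := Character ch0_subproof.

Lemma chadd_subproof (g1 g2 : character) :
  is_character (fun x => g1 x * g2 x).
Proof.
case: g1 g2 => [f1 [c1 n1 h1]] [f2 [c2 n2 h2]] /=; split.
- by move=> x; apply: cvgM; [exact: c1 | exact: c2].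
- by move=> x; rewrite normrM n1 n2 mulr1.
- by move=> x y; rewrite h1 h2 mulrACA.
Qed.

Definition chadd (g1 g2 : dual) : dual := Character (chadd_subproof g1 g2).

Lemma chopp_subproof (g : character) : is_character (fun x => g (- x)).
Proof.
case: g => [f [c n h]] /=; split.
- move=> x; apply: (@continuous_comp _ _ _ (-%R) f).
  + exact: opp_continuous.
  + exact: c.
- by move=> x; rewrite n.
- by move=> x y; rewrite opprD h.
Qed.

Definition chopp (g : dual) : dual := Character (chopp_subproof g).

Definition chtranslate (E : set dual) (g : dual) : set dual :=
  [set chadd e g | e in E].

End Dual.
Arguments dual R G : clear implicits.

Section BSE.
Context {R : realType} {G : topologicalZmodType}.
Local Notation C := (CC R).
Local Notation Gam := (dual R G).

(** A trigonometric polynomial p = \sum_{g in s} c g * g with frequencies in E,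
    given by a duplicate-free list s of characters in E and coefficients c
    (so that c is the Fourier transform hat p on s).  *)
Definition trig_poly (s : seq Gam) (c : Gam -> C) : G -> C :=
  fun x => \sum_(g <- s) c g * chf g x.

Definition span_unit_ball (E : set Gam) (s : seq Gam) (c : Gam -> C) : Prop :=
  [/\ uniq s, (forall g, g \in s -> E g) &
      (forall x : G, `|trig_poly s c x| <= 1)].

Definition bse_norm_at (Vb : set Gam) (g : Gam) (phi : Gam -> C) : \bar R :=
  ereal_sup [set x : \bar R | exists s c,
     span_unit_ball (chtranslate Vb g) s c /\
     x = (cabs (\sum_(h <- s) c h * phi h))%:E].

Definition bse_norm (Vb : set Gam) (phi : Gam -> C) : \bar R :=
  ereal_sup [set bse_norm_at Vb g phi | g in [set: Gam]].

Definition Cb (phi : Gam -> C) : Prop :=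
  continuous phi /\ exists M : R, forall g, cabs (phi g) <= M.

Definition C_BSE (Vb : set Gam) : set (Gam -> C) :=
  [set phi | Cb phi /\ (bse_norm Vb phi < +oo)%E].

Definition Kset (Om : set Gam) : Prop :=
  [/\ compact Om, (interior Om !=set0) & Om `<=` closure (interior Om)].

(** A(Gamma): the limit over the net K(Gamma) (directed by inclusion) of
    sup_{gamma notin Omega} ||psi||^{Vb,gamma} is 0. *)
Definition A_alg (Vb : set Gam) : set (Gam -> C) :=
  [set psi | C_BSE Vb psi /\
     forall eps : R, 0 < eps -> exists2 Om0, Kset Om0 &
       forall Om, Kset Om -> Om0 `<=` Om ->
         (ereal_sup [set bse_norm_at Vb g psi | g in ~` Om] <= eps%:E)%E].

(** real-valued version of ||.||^{Vb} (finite on C_BSE) *)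
Definition bse_normR (Vb : set Gam) (phi : Gam -> C) : R := fine (bse_norm Vb phi).

Definition segal_algebra (Vb : set Gam) (S : set (Gam -> C))
    (nS : (Gam -> C) -> R) : Prop :=
  [/\
      S `<=` A_alg Vb /\ S (fun _ => 0) /\
      (forall phi psi, S phi -> S psi -> S (phi \+ psi)) /\
      (forall (a : C) phi, S phi -> S (fun g => a * phi g)),
      (forall phi psi, S phi -> A_alg Vb psi -> S (phi \* psi)),
      (forall psi, A_alg Vb psi -> forall eps : R, 0 < eps ->
         exists2 phi, S phi & (bse_norm Vb (psi \- phi)%R < eps%:E)%E),
      [/\ (forall phi, S phi -> 0 <= nS phi),
          (forall phi, S phi -> nS phi = 0 -> phi = (fun _ => 0)),
          (forall phi psi, S phi -> S psi -> nS (phi \+ psi) <= nS phi + nS psi),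
          (forall (a : C) phi, S phi -> nS (fun g => a * phi g) = cabs a * nS phi) &
          (forall u : nat -> Gam -> C, (forall n, S (u n)) ->
             (forall eps : R, 0 < eps -> exists N, forall m n, (N <= m)%N -> (N <= n)%N ->
                nS (u m \- u n) < eps) ->
             exists2 l, S l & forall eps : R, 0 < eps -> exists N, forall n, (N <= n)%N ->
                nS (u n \- l) < eps)] &
      [/\
          (forall phi, S phi -> (bse_norm Vb phi <= (nS phi)%:E)%E),
          (forall phi psi, S phi -> A_alg Vb psi ->
             nS (phi \* psi) <= nS phi * bse_normR Vb psi) &
          (forall phi, S phi -> forall eps : R, 0 < eps ->
             exists2 u, S u & nS (phi \- u \* phi) < eps)]].

Definition iso_translation_invariant (S : set (Gam -> C)) (nS : (Gam -> C) -> R) : Prop :=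
  forall psi, S psi -> forall g : Gam,
    S (fun h => psi (chadd h (chopp g))) /\ nS (fun h => psi (chadd h (chopp g))) = nS psi.

Definition multipliers (S : set (Gam -> C)) : set (Gam -> C) :=
  [set phi | Cb phi /\ forall psi, S psi -> S (phi \* psi)].

End BSE.

(* Main.v *)
Require Import Defs.
From HB Require Import structures.
From mathcomp Require Import all_boot all_order all_algebra.
From mathcomp Require Import all_classical all_reals all_analysis.
From mathcomp Require Import complex ring lra.
Import numFieldTopology.Exports numFieldNormedType.Exports.
Import Order.TTheory GRing.Theory Num.Theory.
Set Implicit Arguments.
Unset Strict Implicit.
Unset Printing Implicit Defensive.
Local Open Scope classical_set_scope.
Local Open Scope ring_scope.

(** The local norm over a window [closure V + g] is submultiplicative because
    a trigonometric polynomial may be translated in [G].  Everything rests on a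
    bounded approximate unit of [A_alg]: a uniformly bounded family of compactly
    supported functions equal to 1 on prescribed compact sets.

    Bounded approximate unit.  Hahn-Banach, applied to the covering number
    "least mass of [t >= 0] with [s * f <= t * 1_V] for some probability [s]",
    yields a translation invariant positive functional [I] on the dual group; it is
    nonzero because convolution powers of a finitely supported measure on an
    abelian group have supports of polynomial size.  The same polynomial growth
    gives [<l * k, l * k> <= <k, k>] for the form [<f, g> = I (f g)] whenever the
    trigonometric polynomial of [l] is bounded by 1.  Hence
    [b g = I (1_(V+V) (k (. - g))) / I k] has finite norm; it equals 1 on [V] and has
    relatively compact support.  The functions [1 - \prod_i (1 - b (. - g_i))], with
    [(g_i)] separated, are the required units.

    Inclusion (i).  With bounded units [u_n], the functions [phi u_n psi] form a
    Cauchy sequence in the Segal algebra, and their limit is [phi psi].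

    Equality (ii).  If [phi] is a multiplier, the functionals
    [f |-> \sum c h * phi h * f h], with [\sum c h h] in the unit ball of some window,
    are pointwise bounded, hence uniformly bounded.  Testing them on the translates of
    one element of the Segal algebra close to 1 on [closure V] bounds the norm of
    [phi]. *)

(** * The Hahn-Banach theorem *)

Section HahnBanach.
Context {R : realType} {E : lmodType R}.
Variable L : set E.
Hypothesis LD : forall f g, L f -> L g -> L (f + g).
Hypothesis LZ : forall (s : R) f, L f -> L (s *: f).
Implicit Types (p q : E -> R) (f g : E).

(** Homogeneity is an inequality for positive scalars only: applied to the inverse scalar it gives
    equality. Everything is relative to [L] because the covering number is controlled only on
    dominated functions. *)
Definition sublinear_on q :=
  (forall f g, L f -> L g -> q (f + g) <= q f + q g) /\
  (forall (s : R) f, 0 < s -> L f -> q (s *: f) <= s * q f).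

Lemma opp_closed_on f : L f -> L (- f).
Proof. by move=> Lf; rewrite -scaleN1r; exact: LZ. Qed.

Lemma sublinear0 q f : sublinear_on q -> L f -> q 0 = 0.
Proof.
move=> [_ qZ] Lf; have L0 : L 0 by rewrite -(scale0r f); exact: LZ.
have h2 := qZ 2 0 (ltr0Sn _ 1) L0; have h3 := qZ 2^-1 0 _ L0.
rewrite !scaler0 in h2 h3.
have := h3 ltac:(by rewrite invr_gt0); lra.
Qed.

Lemma sublinear_oppr q f : sublinear_on q -> L f -> - q (- f) <= q f.
Proof.
move=> sq Lf; have := sq.1 f (- f) Lf (opp_closed_on Lf).
by rewrite subrr (sublinear0 sq Lf); lra.
Qed.

Lemma sublinearZ q (s : R) f : sublinear_on q -> L f -> 0 <= s ->
  q (s *: f) = s * q f.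
Proof.
move=> sq Lf; rewrite le0r => /predU1P[->|s0].
  by rewrite scale0r mul0r (sublinear0 sq Lf).
apply/eqP; rewrite eq_le sq.2//=.
have si : 0 < s^-1 by rewrite invr_gt0.
have := sq.2 s^-1 _ si (LZ s Lf).
by rewrite scalerA mulVf ?gt_eqF// scale1r ler_pdivlMl.
Qed.

Lemma le_inf_add (A B : set R) x : A !=set0 -> B !=set0 ->
  (forall a b, A a -> B b -> x <= a + b) -> x <= inf A + inf B.
Proof.
move=> A0 B0 h; rewrite -lerBlDr; apply: lb_le_inf => // a Aa.
rewrite lerBlDr -lerBlDl; apply: lb_le_inf => // b Bb.
by rewrite lerBlDl h.
Qed.

(** The classical modification inf over t >= 0 of q (f + t g) - t q g. A minimal sublinear
    functional cannot decrease under it, which forces it to be odd. *)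
Lemma sublinear_shrink q g : sublinear_on q -> L g ->
  exists p, [/\ sublinear_on p, forall f, L f -> p f <= q f & p (- g) <= - q g].
Proof.
move=> sq Lg.
pose A f := [set x | exists2 t : R, 0 <= t & x = q (f + t *: g) - t * q g].
have A0 f : A f !=set0 by exists (q (f + 0 *: g) - 0 * q g); exists 0.
have lbA f : L f -> lbound (A f) (- q (- f)).
  move=> Lf _ [t t0 ->]; have := sq.1 (f + t *: g) (- f) (LD Lf (LZ t Lg)) (opp_closed_on Lf).
  by rewrite addrAC subrr add0r (sublinearZ sq Lg t0); lra.
have hlb f : L f -> has_lbound (A f) by move=> Lf; eexists; exact: lbA.
exists (fun f => inf (A f)); split.
- split.
  + move=> f1 f2 L1 L2; apply: le_inf_add => // _ _ [t1 t10 ->] [t2 t20 ->].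
    (* The parameters of the two near-infima are added to give one for the sum. *)
    apply: le_trans (_ : q (f1 + f2 + (t1 + t2) *: g) - (t1 + t2) * q g <= _).
      by apply: ge_inf; [exact/hlb/LD | exists (t1 + t2) => //; exact: addr_ge0].
    rewrite scalerDl addrACA.
    have := sq.1 _ _ (LD L1 (LZ t1 Lg)) (LD L2 (LZ t2 Lg)); lra.
  + move=> s f s0 Lf; rewrite -ler_pdivrMl//; apply: lb_le_inf => // _ [t t0 ->].
    rewrite ler_pdivrMl//.
    apply: le_trans (_ : q (s *: f + (s * t) *: g) - (s * t) * q g <= _).
      apply: ge_inf; first exact/hlb/LZ.
      by exists (s * t) => //; rewrite mulr_ge0// ltW.
    rewrite -scalerA -scalerDr mulrBr mulrA lerB//.
    exact: (sq.2 _ _ s0 (LD Lf (LZ t Lg))).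
- move=> f Lf; apply: le_trans (_ : q (f + 0 *: g) - 0 * q g <= _).
    by apply: ge_inf; [exact: hlb | exists 0].
  by rewrite scale0r addr0 mul0r subr0.
- apply: le_trans (_ : q (- g + 1 *: g) - 1 * q g <= _).
    by apply: ge_inf; [exact/hlb/opp_closed_on | exists 1].
  by rewrite scale1r addNr mul1r (sublinear0 sq Lg) sub0r.
Qed.

Lemma sublinear_minimal q : sublinear_on q ->
  exists p, [/\ sublinear_on p, forall f, L f -> p f <= q f &
    forall p', sublinear_on p' -> (forall f, L f -> p' f <= p f) ->
      forall f, L f -> p f <= p' f].
Proof.
move=> sq.
pose Q p := sublinear_on p /\ forall f, L f -> p f <= q f.
pose T := {p | Q p}.
(* The order is reversed, so that the maximal element given by Zorn's lemma is a minimal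
   functional. *)
pose Rl (p p' : T) := `[< forall f, L f -> sval p' f <= sval p f >].
have [] := @ZL_preorder T (exist Q q (conj sq (fun f _ => lexx _))) Rl.
- by move=> p; apply/asboolP.
- move=> p2 p1 p3 /asboolP h1 /asboolP h2; apply/asboolP => f Lf.
  exact: le_trans (h2 _ Lf) (h1 _ Lf).
- move=> A totA.
  have [[p0 Ap0]|A0] := pselect (A !=set0); last first.
    exists (exist Q q (conj sq (fun f _ => lexx _))) => s As.
    by exfalso; apply: A0; exists s.
  pose B f := [set sval p f | p in A].
  have B0 f : B f !=set0 by exists (sval p0 f); exists p0.
  have hlb f : L f -> has_lbound (B f).
    move=> Lf; exists (- q (- f)) => _ [[p [sp ple]] _ <-] /=.
    by have := sublinear_oppr sp Lf; have := ple _ (opp_closed_on Lf); lra.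
  have sB : sublinear_on (fun f => inf (B f)).
    split.
      move=> f g Lf Lg; apply: le_inf_add => // _ _ [p1 A1 <-] [p2 A2 <-].
      (* In a chain the smaller of [p1] and [p2] serves for both terms. *)
      have [p Ap [le1 le2]] : exists2 p, A p & sval p f <= sval p1 f /\
          sval p g <= sval p2 g.
        by have [/asboolP h|/asboolP h] := totA _ _ A1 A2; [exists p2|exists p1];
          rewrite ?h ?lexx.
      apply: le_trans (_ : sval p (f + g) <= _).
        by apply: ge_inf; [exact/hlb/LD|exists p].
      by have := (svalP p).1.1 f g Lf Lg; lra.
    move=> s f s0 Lf; rewrite -ler_pdivrMl//; apply: lb_le_inf => // _ [p Ap <-].
    rewrite ler_pdivrMl//; apply: le_trans (_ : sval p (s *: f) <= _).
      by apply: ge_inf; [exact/hlb/LZ|exists p].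
    exact: ((svalP p).1.2 _ _ s0 Lf).
  have leB f : L f -> inf (B f) <= q f.
    move=> Lf; apply: le_trans (_ : sval p0 f <= _).
      by apply: ge_inf; [exact: hlb|exists p0].
    exact: (svalP p0).2.
  exists (exist Q _ (conj sB leB)) => p Ap; apply/asboolP => f Lf /=.
  by apply: ge_inf; [exact: hlb|exists p].
- move=> [p [sp ple]] pmax; exists p; split => // p' sp' p'le f Lf.
  have p'q g : L g -> p' g <= q g.
    by move=> Lg; exact: le_trans (p'le _ Lg) (ple _ Lg).
  have /pmax/asboolP/(_ f Lf) // : Rl (exist Q p (conj sp ple))
    (exist Q p' (conj sp' p'q)) by apply/asboolP.
Qed.

(** Shrinking at [g] first forces the value q g at [g]. Shrinking the minimal functional [I] at any
    f gives, by minimality, I (- f) <= - I f; so [I] is odd, and an odd sublinear functional is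
    linear. *)
Lemma hahn_banach q g : sublinear_on q -> L g -> exists I : E -> R,
  [/\ forall f1 f2, L f1 -> L f2 -> I (f1 + f2) = I f1 + I f2,
      forall (s : R) f, L f -> I (s *: f) = s * I f,
      forall f, L f -> I f <= q f & I g = q g].
Proof.
move=> sq Lg; have [q' [sq' q'q q'g]] := sublinear_shrink sq Lg.
have [I [sI Iq' Imin]] := sublinear_minimal sq'.
have IN f : L f -> I (- f) = - I f.
  move=> Lf; have [p [sp pI pf]] := sublinear_shrink sI Lf.
  have := Imin _ sp pI _ (opp_closed_on Lf); have := sublinear_oppr sI Lf; lra.
exists I; split.
- move=> f1 f2 L1 L2; have := sI.1 _ _ L1 L2.
  have := sI.1 _ _ (opp_closed_on L1) (opp_closed_on L2); rewrite -opprD !IN//; last exact: LD.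
  lra.
- move=> s f Lf; have [s0|s0] := leP 0 s; first exact: sublinearZ.
  have := IN _ (LZ (- s) Lf); rewrite -scaleNr opprK => ->.
  by rewrite sublinearZ// ?oppr_ge0 1?ltW// mulNr opprK.
- by move=> f Lf; exact: le_trans (Iq' _ Lf) (q'q _ Lf).
- have := Iq' _ (opp_closed_on Lg); have := Iq' _ Lg; have := q'q _ Lg.
  by rewrite IN//; lra.
Qed.

End HahnBanach.

(** * Finitely supported measures and polynomial growth *)

(** If x = 1 + h with h > 0, then h n <= x^n, and for M = 2^m, n = 2^j the hypothesis at n M gives
    (h n)^M <= (n M + 1)^m <= (2 M)^M n^(M - 1): thus h^M n stays bounded, which is absurd. Taking M
    a power of two keeps n M one. *)
Lemma le1_of_poly_growth {R : realType} (x : R) m : 0 <= x ->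
  (forall j, x ^+ (2 ^ j) <= ((2 ^ j).+1 ^ m)%:R) -> x <= 1.
Proof.
move=> x0 hx; rewrite leNgt; apply/negP => x1.
pose h := x - 1; have h0 : 0 < h by rewrite /h subr_gt0.
have mM : (m < 2 ^ m)%N by exact: ltn_expl.
set M := (2 ^ m)%N in mM.
have M0 : (0 < M)%N by exact: leq_ltn_trans mM.
have bern n : h * n%:R <= x ^+ n.
  elim: n => [|n IH]; first by rewrite mulr0 expr0.
  have : 1 <= x ^+ n by exact/exprn_ege1/ltW.
  have -> : x ^+ n.+1 = x ^+ n + h * x ^+ n by rewrite /h exprS; ring.
  rewrite -natr1 mulrDr mulr1 => h1; rewrite lerD//.
  by rewrite ler_peMr// ltW.
have key j : h ^+ M * (2 ^ j)%:R <= ((2 * M) ^ M)%:R.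
  have n0 : (0 < 2 ^ j)%N by rewrite expn_gt0.
  set n := (2 ^ j)%N in n0 *.
  have -> : h ^+ M * n%:R = (h * n%:R) ^+ M / n%:R ^+ M.-1.
    have nM : n%:R ^+ M = n%:R * n%:R ^+ M.-1 :> R by rewrite -exprS prednK.
    rewrite exprMn nM !mulrA mulfK//.
    by rewrite expf_neq0// pnatr_eq0 -lt0n.
  rewrite ler_pdivrMr; last by rewrite exprn_gt0// ltr0n.
  apply: (@le_trans _ _ (x ^+ (n * M))).
    by rewrite exprM lerXn2r ?nnegrE// ?exprn_ge0// mulr_ge0// ltW.
  rewrite -natrX -natrM /n /M -expnD.
  apply: le_trans (hx _) _; rewrite ler_nat expnD -/n -/M.
  apply: (@leq_trans ((2 * M * n) ^ m)).
    have [->//|m0] := posnP m.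
    rewrite leq_exp2r// -mulnA mul2n -addnn (mulnC n).
    by rewrite -[X in (X < _)%N]addn0 ltn_add2l muln_gt0 M0.
  rewrite expnMn; apply: leq_mul.
    by apply: leq_pexp2l; [rewrite muln_gt0|exact: ltnW].
  by apply: leq_pexp2l => //; rewrite -ltnS prednK.
have [n hn] : exists n : nat, ((2 * M) ^ M)%:R / h ^+ M < n%:R :> R.
  by eexists; exact: truncnS_gt.
have := key n; rewrite mulrC -ler_pdivlMr ?exprn_gt0// => /le_lt_trans /(_ hn).
by rewrite ltr_nat => /(ltn_trans (ltn_expl n (ltnSn 1))); rewrite ltnn.
Qed.

Section FiniteMeasures.
Context {R : realType} {X : zmodType}.
Implicit Types (l : seq (R * X)) (f g : X -> R).

(** A list of pairs (weight, point), repetitions allowed, stands for a finitely supported measure.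
    In this reading [mulm] is the convolution of measures, [coefm] collects repeated points and
    [starm] reflects by x -> - x. *)
Definition convol l f : X -> R := fun x => \sum_(a <- l) a.1 * f (x - a.2).
Definition mass l : R := \sum_(a <- l) a.1.
Definition nonneg_meas l := forall a, a \in l -> 0 <= a.1.
Definition mulm l1 l2 : seq (R * X) :=
  [seq (a.1 * b.1, a.2 + b.2) | a <- l1, b <- l2].
Definition powm l n := iter n (mulm l) [:: (1, 0)].
Definition coefm l (g : X) : R := \sum_(a <- l | a.2 == g) a.1.
Definition starm l : seq (R * X) := [seq (a.1, - a.2) | a <- l].

Lemma convol_mulm l1 l2 f : convol (mulm l1 l2) f = convol l1 (convol l2 f).
Proof.
apply/funext => x; rewrite /convol big_allpairs_dep; apply: eq_bigr => a _.
rewrite big_distrr /=; apply: eq_bigr => b _.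
by rewrite mulrA opprD addrA.
Qed.

Lemma convol_powm l n f : convol (powm l n) f = iter n (convol l) f.
Proof.
elim: n => [|n IH] /=; last by rewrite convol_mulm IH.
by apply/funext => x; rewrite /convol big_seq1/= mul1r subr0.
Qed.

Lemma convolC l1 l2 f : convol l1 (convol l2 f) = convol l2 (convol l1 f).
Proof.
apply/funext => x; rewrite /convol.
under eq_bigr do rewrite big_distrr.
rewrite exchange_big /=; apply: eq_bigr => b _.
rewrite big_distrr /=; apply: eq_bigr => a _.
by rewrite mulrCA addrAC.
Qed.

Lemma convol_cat l1 l2 f : convol (l1 ++ l2) f = convol l1 f \+ convol l2 f.
Proof. by apply/funext => x; rewrite /convol big_cat. Qed.

Lemma convolD l f g : convol l (f \+ g) = convol l f \+ convol l g.
Proof.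
apply/funext => x; rewrite /convol /= -big_split /=; apply: eq_bigr => a _.
by rewrite mulrDr.
Qed.

Lemma convolZ l s f : convol l (fun x => s * f x) = fun x => s * convol l f x.
Proof.
apply/funext => x; rewrite /convol big_distrr; apply: eq_bigr => a _ /=.
by rewrite mulrCA.
Qed.

Definition scalem (s : R) l : seq (R * X) := [seq (s * a.1, a.2) | a <- l].

Lemma convol_scalem s l f : convol (scalem s l) f = fun x => s * convol l f x.
Proof.
apply/funext => x; rewrite /convol big_map big_distrr; apply: eq_bigr => a _ /=.
by rewrite mulrA.
Qed.

Lemma le_conv l f g : nonneg_meas l -> (forall x, f x <= g x) ->
  forall x, convol l f x <= convol l g x.
Proof.
move=> l0 fg x; rewrite /convol big_seq [leRHS]big_seq; apply: ler_sum => a al.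
exact: ler_wpM2l (l0 _ al) _ _ (fg _).
Qed.

Lemma nonneg_cat l1 l2 : nonneg_meas l1 -> nonneg_meas l2 -> nonneg_meas (l1 ++ l2).
Proof. by move=> h1 h2 a; rewrite mem_cat => /orP[/h1|/h2]. Qed.

Lemma nonneg_mulm l1 l2 : nonneg_meas l1 -> nonneg_meas l2 -> nonneg_meas (mulm l1 l2).
Proof. by move=> h1 h2 _ /allpairsP[[a b] [/h1 ? /h2 ? ->]]; exact: mulr_ge0. Qed.

Lemma nonneg_powm l n : nonneg_meas l -> nonneg_meas (powm l n).
Proof.
move=> h; elim: n => [|n IH] /=; last exact: nonneg_mulm.
by move=> a; rewrite inE => /eqP ->.
Qed.

Lemma nonneg_scalem s l : 0 <= s -> nonneg_meas l -> nonneg_meas (scalem s l).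
Proof. by move=> s0 h _ /mapP[a /h ? ->]; exact: mulr_ge0. Qed.

Lemma mass_cat l1 l2 : mass (l1 ++ l2) = mass l1 + mass l2.
Proof. exact: big_cat. Qed.

Lemma mass_mulm l1 l2 : mass (mulm l1 l2) = mass l1 * mass l2.
Proof.
rewrite /mass big_allpairs_dep big_distrl; apply: eq_bigr => a _ /=.
by rewrite big_distrr.
Qed.

Lemma mass_powm l n : mass (powm l n) = mass l ^+ n.
Proof.
elim: n => [|n IH] /=; first by rewrite /mass big_seq1.
by rewrite mass_mulm IH exprS.
Qed.

Lemma mass_scalem s l : mass (scalem s l) = s * mass l.
Proof. by rewrite /mass big_map big_distrr. Qed.

Lemma mass_ge0 l : nonneg_meas l -> 0 <= mass l.
Proof. by move=> h; rewrite /mass big_seq sumr_ge0// => a /h. Qed.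

Lemma sum_coefm l f :
  \sum_(a <- l) a.1 * f a.2 = \sum_(g <- undup (unzip2 l)) coefm l g * f g.
Proof.
rewrite /coefm; under [RHS]eq_bigr do rewrite big_distrl /=.
rewrite (exchange_big_dep xpredT) //= big_seq [RHS]big_seq; apply: eq_bigr => a al.
rewrite -big_filter (_ : [seq _ <- _ | _] = [:: a.2]) ?big_seq1//.
rewrite (eq_filter (a2 := pred1 a.2)); last by move=> y /=; rewrite eq_sym.
by rewrite filter_pred1_uniq ?undup_uniq// mem_undup map_f.
Qed.

(** A box of polynomial size in [n], meant to contain the support of the n-th convolution power:
    sums of members of [s] with multiplicities at most [n]. *)
Fixpoint combs (s : seq X) n : seq X :=
  if s is x :: s' then [seq x *+ i + y | i <- iota 0 n.+1, y <- combs s' n]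
  else [:: 0].

Lemma size_combs s n : size (combs s n) = (n.+1 ^ size s)%N.
Proof.
elim: s => //= x s IH; rewrite size_cat size_map -/(allpairs _ _ _) size_allpairs.
by rewrite size_iota IH expnS mulSn.
Qed.

Lemma combs_consP x s n z : reflect
  (exists i y, [/\ (i <= n)%N, y \in combs s n & z = x *+ i + y])
  (z \in combs (x :: s) n).
Proof.
apply: (iffP allpairsP) => [[[i y] [iin ys ->]]|[i [y [ile ys ->]]]].
  by exists i, y; split => //; move: iin; rewrite mem_iota.
by exists (i, y); split; rewrite // mem_iota.
Qed.

Lemma combsS s n z : z \in combs s n -> z \in combs s n.+1.
Proof.
elim: s z => // x s IH z /combs_consP[i [y [ile /IH ys ->]]].
by apply/combs_consP; exists i, y; split; rewrite // leqW.
Qed.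

Lemma combs_add s n x z : x \in s -> z \in combs s n -> x + z \in combs s n.+1.
Proof.
elim: s z => // w s IH z; rewrite in_cons => /predU1P[->|xs];
    move=> /combs_consP[i [y [ile ys ->]]]; apply/combs_consP.
  by exists i.+1, y; rewrite addrA -mulrS; split; rewrite // combsS.
by exists i, (x + y); rewrite addrCA leqW//; split; rewrite // IH.
Qed.

(* A sum of n elements of an abelian group is determined by the
   multiplicities of its terms: this is the polynomial growth. *)
Lemma size_supp_powm l n :
  (size (undup (unzip2 (powm l n))) <= n.+1 ^ size l)%N.
Proof.
rewrite -(size_map snd l) -size_combs; apply: uniq_leq_size; first exact: undup_uniq.
move=> z; rewrite mem_undup; elim: n z => [|n IH] z.
  rewrite /= inE => /eqP ->; elim: (map _ _) => [|y s IHs]; first by rewrite mem_seq1.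
  by apply/combs_consP; exists 0%N, 0; rewrite mulr0n addr0.
case/mapP => _ /allpairsP[[a b] [/= al bl ->]] -> /=.
by apply: combs_add; [exact: map_f|apply: IH; exact: map_f].
Qed.

Section Indicator.
Variables (P : set X) (p0 : X).
Hypothesis Pp0 : P p0.

(** Since convolutions commute, the domination passes to powers: s^n * 1_P <= t^n * 1_P <= (mass
    t)^n. So each atom of s^n is at most (mass t)^n, and there are polynomially many of them while
    their total is 1. Hence the powers of 1 / mass t grow at most polynomially. *)
Lemma mass_domination s t : nonneg_meas s -> nonneg_meas t -> mass s = 1 ->
  (forall x, convol s \1_P x <= convol t \1_P x) -> 1 <= mass t.
Proof.
move=> s0 t0 s1 st.
have ind0 x : 0 <= \1_P x :> R by rewrite indicE.
have pw n x : convol (powm s n) \1_P x <= convol (powm t n) \1_P x.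
  elim: n x => [|n IH] x //=.
  rewrite !convol_mulm; apply: le_trans (le_conv s0 IH x) _.
  rewrite (convolC s) (convolC t).
  exact: (le_conv (nonneg_powm t0) st).
have up n x : convol (powm t n) \1_P x <= mass t ^+ n.
  rewrite -mass_powm /convol /mass big_seq [leRHS]big_seq; apply: ler_sum => a al.
  apply: ler_piMr; first exact: nonneg_powm t0 _ al.
  by rewrite indicE; case: (x - a.2 \in P).
have low n : 1 <= (n.+1 ^ size s)%:R * mass t ^+ n.
  suff : mass (powm s n) <= (n.+1 ^ size s)%:R * mass t ^+ n by rewrite mass_powm s1 expr1n.
  have := sum_coefm (powm s n) (fun=> 1).
  under eq_bigr do rewrite mulr1; rewrite -/(mass _) => ->.
  under eq_bigr do rewrite mulr1.
  apply: (@le_trans _ _ (\sum_(g <- undup (unzip2 (powm s n))) mass t ^+ n)).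
    (* Evaluation at g + p0 catches all the mass of s^n at g, because [p0] lies in [P]. *)
    apply: ler_sum => g _; apply: le_trans (up n (g + p0)); apply: le_trans (pw _ _).
    rewrite /coefm /convol [leLHS]big_mkcond /=; rewrite big_seq [leRHS]big_seq.
    apply: ler_sum => a al; case: eqP => [->|_].
      by rewrite addrAC subrr add0r indicE mem_set// mulr1.
    by rewrite mulr_ge0// (nonneg_powm s0 al).
  rewrite big_const_seq count_predT iter_addr_0 -[leLHS]mulr_natl.
  apply: ler_wpM2r; first by rewrite exprn_ge0 ?mass_ge0.
  by rewrite ler_nat size_supp_powm.
have tgt0 : 0 < mass t.
  rewrite lt_neqAle mass_ge0// andbT; apply/eqP => t00.
  by have := low 1%N; rewrite -t00 expr1 mulr0 ler10.
rewrite -[leRHS]invrK -[leLHS]invr1 lef_pV2 ?posrE ?invr_gt0//.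
apply: (@le1_of_poly_growth _ _ (size s)); first by rewrite invr_ge0 ltW.
move=> j; rewrite exprVn -[leLHS]mul1r ler_pdivrMr ?exprn_gt0//.
Qed.

End Indicator.
End FiniteMeasures.

(** * Invariant functionals *)

Section InvariantFunctional.
Context {R : realType} {X : zmodType}.
Variables (P : set X) (p0 : X).
Hypothesis Pp0 : P p0.
Implicit Types (f g : X -> R) (s t l : seq (R * X)).

(** These are the bounded functions supported in finitely many translates of [P], the domain of the
    invariant functional. *)
Definition dominated f :=
  exists2 l, nonneg_meas l & forall x, `|f x| <= convol l \1_P x.

Definition translate (a : X) f : X -> R := fun x => f (x - a).

Lemma indic_ge0 x : 0 <= \1_P x :> R. Proof. by rewrite indicE. Qed.

Lemma dominatedD f g : dominated f -> dominated g -> dominated (f \+ g).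
Proof.
move=> [l l0 hl] [t t0 ht]; exists (l ++ t); first exact: nonneg_cat.
move=> x; rewrite convol_cat /=; apply: le_trans (ler_normD _ _) _.
exact: lerD.
Qed.

Lemma dominated_le f g (M : R) : dominated f -> 0 <= M ->
  (forall x, `|g x| <= M * `|f x|) -> dominated g.
Proof.
move=> [l l0 hl] M0 gf; exists (scalem M l); first exact: nonneg_scalem.
move=> x; rewrite convol_scalem; apply: le_trans (gf x) _.
exact: ler_wpM2l (hl x).
Qed.

Lemma dominatedZ (a : R) f : dominated f -> dominated (fun x => a * f x).
Proof.
by move=> df; apply: (dominated_le (M := `|a|) df) => // x; rewrite normrM.
Qed.

Lemma dominated_bounded f : dominated f -> exists2 M : R, 0 <= M & forall x, `|f x| <= M.
Proof.
move=> [l l0 hl]; exists (mass l); first exact: mass_ge0.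
move=> x; apply: le_trans (hl x) _; rewrite /convol /mass big_seq [leRHS]big_seq.
apply: ler_sum => a al; apply: ler_piMr; first exact: l0.
by rewrite indicE; case: (x - a.2 \in P).
Qed.

Lemma dominatedM f g : dominated f -> dominated g -> dominated (f \* g).
Proof.
move=> df /dominated_bounded[M M0 gM]; apply: (dominated_le df M0) => x /=.
by rewrite normrM mulrC ler_wpM2r.
Qed.

Lemma dominated_conv l f : dominated f -> dominated (convol l f).
Proof.
move=> [t t0 ht]; pose l' := [seq (`|a.1|, a.2) | a <- l].
have l'0 : nonneg_meas l' by move=> _ /mapP[a _ ->]; exact: normr_ge0.
exists (mulm l' t); first exact: nonneg_mulm.
move=> x; rewrite convol_mulm /convol -/(convol _ _) big_map.
apply: le_trans (ler_norm_sum _ _ _) _; apply: ler_sum => a _ /=.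
by rewrite normrM ler_wpM2l.
Qed.

Lemma convol1 a f : convol [:: (1, a)] f = translate a f.
Proof. by apply/funext => x; rewrite /convol big_seq1 mul1r. Qed.

Lemma dominated_shift a f : dominated f -> dominated (translate a f).
Proof. by rewrite -convol1; exact: dominated_conv. Qed.

Lemma dominated_indic : dominated \1_P.
Proof.
exists [:: (1, 0)]; first by move=> a; rewrite inE => /eqP ->.
by move=> x; rewrite convol1 /translate subr0 ger0_norm// indic_ge0.
Qed.

(** Averaging [f] by a probability [s] before covering it is what makes the differences f - f (. -
    a) negligible, hence the functional invariant. *)
Definition cover_masses f : set R := [set mass t | t in
  [set t | nonneg_meas t /\ exists s, [/\ nonneg_meas s, mass s = 1 &
     forall x, convol s f x <= convol t \1_P x]]].

Lemma cover_masses_lb f : has_lbound (cover_masses f).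
Proof. by exists 0 => _ [t [t0 _] <-]; exact: mass_ge0. Qed.

Lemma nonneg_dirac : nonneg_meas [:: (1 : R, 0 : X)].
Proof. by move=> a; rewrite inE => /eqP ->. Qed.

Lemma mass_dirac : mass [:: (1 : R, 0 : X)] = 1.
Proof. by rewrite /mass big_seq1. Qed.

Lemma cover_masses_neq0 f : dominated f -> cover_masses f !=set0.
Proof.
move=> [t t0 ht]; exists (mass t), t => //; split => //.
exists [:: (1, 0)]; split; [exact: nonneg_dirac|exact: mass_dirac|].
move=> x; rewrite convol1 /translate subr0; apply: le_trans (ht x); exact: ler_norm.
Qed.

Definition cover_number f : R := inf (cover_masses f).

Lemma cover_number_le f s t : nonneg_meas s -> mass s = 1 -> nonneg_meas t ->
  (forall x, convol s f x <= convol t \1_P x) -> cover_number f <= mass t.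
Proof.
move=> s0 s1 t0 st; apply: ge_inf; first exact: cover_masses_lb.
by exists t => //; split => //; exists s.
Qed.

(** The common average is s1 s2; each probability also acts on the cover of the other function,
    which leaves the masses unchanged. *)
Lemma cover_numberD f g : dominated f -> dominated g ->
  cover_number (f \+ g) <= cover_number f + cover_number g.
Proof.
move=> df dg; apply: le_inf_add; [exact: cover_masses_neq0|exact: cover_masses_neq0|].
move=> _ _ [t1 [t10 [s1 [s10 m1 h1]]] <-] [t2 [t20 [s2 [s20 m2 h2]]] <-].
have -> : mass t1 + mass t2 = mass (mulm s2 t1 ++ mulm s1 t2).
  by rewrite mass_cat !mass_mulm m1 m2 !mul1r.
apply: (@cover_number_le _ (mulm s1 s2)).
- exact: nonneg_mulm.
- by rewrite mass_mulm m1 m2 mulr1.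
- by apply: nonneg_cat; exact: nonneg_mulm.
move=> x; rewrite convol_cat convolD /= !convol_mulm (convolC s1).
by apply: lerD; exact: le_conv.
Qed.

Lemma cover_numberZ (a : R) f : 0 < a -> dominated f ->
  cover_number (fun x => a * f x) <= a * cover_number f.
Proof.
move=> a0 df; rewrite -ler_pdivrMl//; apply: lb_le_inf; first exact: cover_masses_neq0.
move=> _ [t [t0 [s [s0 s1 st]]] <-]; rewrite ler_pdivrMl// -mass_scalem.
apply: cover_number_le s0 s1 (nonneg_scalem (ltW a0) t0) _ => x.
by rewrite convol_scalem convolZ ler_wpM2l// ltW.
Qed.

(** This is where the functional is kept from vanishing: rescaling [t] by the inverse of [a] reduces
    the bound to [mass_domination]. *)
Lemma cover_number_indic (a : R) : 0 < a -> a <= cover_number (fun x => a * \1_P x).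
Proof.
move=> a0; apply: lb_le_inf; first exact/cover_masses_neq0/dominatedZ/dominated_indic.
move=> _ [t [t0 [s [s0 s1 st]]] <-].
suff : 1 <= mass (scalem a^-1 t) by rewrite mass_scalem ler_pdivlMl// mulr1.
apply: (mass_domination Pp0 s0 _ s1) => [|x].
  by apply: nonneg_scalem => //; rewrite invr_ge0 ltW.
by rewrite convol_scalem ler_pdivlMl//; have := st x; rewrite convolZ.
Qed.

(* Averaging over the multiples of a makes the telescoping difference small. *)
Lemma cover_number_shift a f : dominated f -> cover_number (f \- translate a f) <= 0.
Proof.
move=> df; have [l l0 hl] := df; apply/ler_addgt0Pr => e e0; rewrite add0r.
(* The telescoped average is (f x - f (x - n a)) / n, covered by two copies of [l] of total mass 2
   mass l / n. *)
have [n hn] : exists n : nat, (2 * mass l) / e < n%:R by eexists; exact: truncnS_gt.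
have n0 : 0 < n%:R :> R.
  apply: le_lt_trans hn; apply: divr_ge0; last exact: ltW.
  by rewrite mulr_ge0// mass_ge0.
pose s := [seq (n%:R^-1 : R, a *+ j) | j <- iota 0 n].
pose t := scalem n%:R^-1 (l ++ mulm [:: (1, a *+ n)] l).
have t0 : nonneg_meas t.
  apply: nonneg_scalem; first by rewrite invr_ge0 ltW.
  apply: nonneg_cat => //; apply: nonneg_mulm => //.
  by move=> b; rewrite inE => /eqP ->.
apply: (@le_trans _ _ (mass t)).
  apply: (cover_number_le (s := s)) => //.
  - by move=> _ /mapP[j _ ->]; rewrite invr_ge0 ltW.
  - rewrite /mass big_map big_const_seq count_predT size_iota iter_addr_0.
    by rewrite -[LHS]mulr_natl mulfV// gt_eqF.
  move=> x; rewrite convol_scalem convol_cat convol_mulm convol1 /=.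
  have -> : convol s (f \- translate a f) x = n%:R^-1 * (f x - f (x - a *+ n)).
    rewrite /convol big_map -big_distrr /=; congr (_ * _).
    have -> : f x - f (x - a *+ n) = - (f (x - a *+ n) - f (x - a *+ 0)).
      by rewrite mulr0n subr0 opprB.
    rewrite -(telescope_sumr (fun j => f (x - a *+ j)))// -sumrN.
    rewrite /index_iota subn0; apply: eq_bigr => j _.
    by rewrite opprB mulrS opprD addrA /translate /= addrAC.
  rewrite ler_wpM2l ?invr_ge0 ?(ltW n0)//.
  have := hl x; have := hl (x - a *+ n); rewrite /translate !ler_norml; lra.
rewrite mass_scalem mass_cat mass_mulm [X in _ + X * _]/mass big_seq1 mul1r.
rewrite ler_pdivrMl//; move: hn; rewrite ltr_pdivrMr//; lra.
Qed.

Definition invariant_functional (I : (X -> R) -> R) :=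
  [/\ (forall f g, dominated f -> dominated g -> I (f \+ g) = I f + I g),
      (forall (a : R) f, dominated f -> I (fun x => a * f x) = a * I f),
      (forall f, dominated f -> (forall x, 0 <= f x) -> 0 <= I f),
      (forall f a, dominated f -> I (translate a f) = I f) & I \1_P = 1].

Lemma exists_invariant_functional : exists I, invariant_functional I.
Proof.
have DD : forall f g : X -> R^o, dominated f -> dominated g -> dominated (f + g).
  exact: dominatedD.
have DZ : forall (a : R) (f : X -> R^o), dominated f -> dominated (a *: f).
  exact: dominatedZ.
have sc : @sublinear_on R (X -> R^o) dominated cover_number.
  split; first exact: cover_numberD.
  by move=> a f a0; exact: cover_numberZ.
have [I [ID IZ Iq I1]] := hahn_banach DD DZ sc dominated_indic.
have IN f : dominated f -> I (fun x => - f x) = - I f.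
  move=> df; have := IZ (-1) f df; rewrite mulN1r => <-; congr I.
  by apply/funext => x; exact/esym/mulN1r.
have dN f : dominated f -> dominated (fun x => - f x).
  by move=> df; apply: (dominated_le df ler01) => x; rewrite normrN mul1r.
have cD f g : dominated f -> dominated g -> I (f \+ g) = I f + I g by exact: ID.
(* The difference has covering number at most 0, which gives one inequality; the other follows by
   translating back by - a. *)
have Ishift f a : dominated f -> I f <= I (translate a f).
  move=> df; have ds := dominated_shift a df.
  have := le_trans (Iq _ (dominatedD df (dN _ ds))) (cover_number_shift a df).
  by rewrite cD//; [rewrite IN// subr_le0|exact: dN].
exists I; split => //.
(* For f >= 0 the function - f is covered by the empty measure, of mass 0. *)
- move=> f df f0; rewrite -oppr_le0 -IN//; apply: le_trans (Iq _ (dN _ df)) _.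
  have -> : 0 = mass ([::] : seq (R * X)) by rewrite /mass big_nil.
  apply: (cover_number_le nonneg_dirac mass_dirac) => [a|x]; first by rewrite in_nil.
  by rewrite convol1 /translate subr0 /convol big_nil oppr_le0.
- move=> f a df; apply/eqP; rewrite eq_le Ishift// andbT.
  apply: le_trans (Ishift _ (- a) (dominated_shift a df)) _.
  rewrite (_ : translate _ _ = f)//; apply/funext => x.
  by rewrite /translate opprK addrK.
- have := cover_number_le nonneg_dirac mass_dirac nonneg_dirac (f := \1_P).
  rewrite mass_dirac => /(_ (fun=> lexx _)) le1; apply/eqP.
  rewrite I1 eq_le le1/=; have := cover_number_indic ltr01.
  by rewrite (_ : (fun x => 1 * \1_P x) = \1_P)//; apply/funext => x; rewrite mul1r.
Qed.

(** * The quadratic form of an invariant functional *)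

Section NormBound.
Variable I : (X -> R) -> R.
Hypothesis HI : invariant_functional I.

Let ID := let: And5 h _ _ _ _ := HI in h.
Let IZ := let: And5 _ h _ _ _ := HI in h.
Let I_ge0 := let: And5 _ _ h _ _ := HI in h.
Let Ish := let: And5 _ _ _ h _ := HI in h.

Lemma functional_le f g : dominated f -> dominated g -> (forall x, f x <= g x) ->
  I f <= I g.
Proof.
move=> df dg fg; have df' := dominatedZ (-1) df.
have := I_ge0 (dominatedD dg df'); rewrite ID// IZ// mulN1r subr_ge0; apply.
by move=> x; rewrite /= mulN1r subr_ge0.
Qed.

Lemma functional_norm_le f g : dominated f -> dominated g ->
  (forall x, `|f x| <= g x) -> `|I f| <= I g.
Proof.
move=> df dg fg; rewrite ler_norml; apply/andP; split.
  rewrite -mulN1r -IZ//; apply: functional_le => //; first exact: dominatedZ.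
  by move=> x; have := fg x; rewrite ler_norml => /andP[]; lra.
by apply: functional_le => // x; apply: le_trans (fg x); exact: ler_norm.
Qed.

Lemma functional_sum (T : Type) (r : seq T) (c : T -> R) (F : T -> X -> R) :
  (forall i, dominated (F i)) ->
  dominated (fun x => \sum_(i <- r) c i * F i x) /\
  I (fun x => \sum_(i <- r) c i * F i x) = \sum_(i <- r) c i * I (F i).
Proof.
move=> dF; elim: r => [|i r [d IH]].
  have -> : (fun x => \sum_(i <- [::]) c i * F i x) = (fun x => 0 * \1_P x).
    by apply/funext => x; rewrite big_nil mul0r.
  split; first exact/dominatedZ/dominated_indic.
  by rewrite IZ ?mul0r ?big_nil//; exact: dominated_indic.
have -> : (fun x => \sum_(j <- i :: r) c j * F j x) =
    (fun x => c i * F i x) \+ (fun x => \sum_(j <- r) c j * F j x).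
  by apply/funext => x; rewrite big_cons.
split; first by apply: dominatedD => //; exact: dominatedZ.
by rewrite ID ?IZ ?big_cons ?IH//; exact: dominatedZ.
Qed.

Lemma functional_shift_mul f g a : dominated f -> dominated g ->
  I (translate a f \* g) = I (f \* translate (- a) g).
Proof.
move=> df dg; rewrite -[RHS](Ish a); last by apply: dominatedM => //; exact: dominated_shift.
congr I; apply/funext => x; rewrite /translate /= opprK subrK //.
Qed.

(** For the form I (f g), convolution by [l] and by [starm l] are adjoint, by translation
    invariance. *)
Lemma functional_convol_mul l f g : dominated f -> dominated g ->
  I (convol l f \* g) = I (f \* convol (starm l) g).
Proof.
move=> df dg.
have -> : convol l f \* g = fun x => \sum_(a <- l) a.1 * (translate a.2 f \* g) x.
  by apply/funext => x; rewrite /= big_distrl; apply: eq_bigr => a _; rewrite /= mulrA.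
have -> : f \* convol (starm l) g = fun x => \sum_(a <- l) a.1 * (f \* translate (- a.2) g) x.
  apply/funext => x; rewrite /= /convol big_map big_distrr; apply: eq_bigr => a _.
  by rewrite /= mulrCA.
rewrite !(fun F dF => (@functional_sum _ l fst F dF).2).
- by apply: eq_bigr => a _; rewrite functional_shift_mul.
- by move=> a; apply: dominatedM => //; exact: dominated_shift.
- by move=> a; apply: dominatedM => //; exact: dominated_shift.
Qed.

Lemma functional_sqr_ge0 f : dominated f -> 0 <= I (f \* f).
Proof. by move=> df; apply: I_ge0; [exact: dominatedM|move=> x; exact: sqr_ge0]. Qed.

Lemma functional_CauchySchwarz f g : dominated f -> dominated g ->
  I (f \* g) ^+ 2 <= I (f \* f) * I (g \* g).
Proof.
move=> df dg; set A := I (f \* f); set B := I (f \* g); set C := I (g \* g).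
have key (t u : R) : 0 <= t ^+ 2 * A + (2 * t * u) * B + u ^+ 2 * C.
  have d1 := dominatedM df df; have d2 := dominatedM df dg; have d3 := dominatedM dg dg.
  rewrite /A /B /C -!IZ// -!ID//; try by repeat (apply: dominatedD || apply: dominatedZ).
  have dh := dominatedD (dominatedZ t df) (dominatedZ u dg).
  have := functional_sqr_ge0 dh; congr (0 <= I _).
  by apply/funext => x /=; ring.
have A0 : 0 <= A := functional_sqr_ge0 df.
(* The test vector (B, - A) gives A (A C - B^2) >= 0. When A = 0 this says nothing, and (- (C + 1),
   B) gives - (C + 2) B^2 >= 0, so B = 0. *)
have [A00|A00] := eqVneq A 0; last first.
  have := key B (- A); have {}A0 : 0 < A by rewrite lt_neqAle eq_sym A00.
  have -> : B ^+ 2 * A + 2 * B * - A * B + (- A) ^+ 2 * C = A * (A * C - B ^+ 2) by ring.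
  by rewrite pmulr_rge0// subr_ge0.
rewrite A00 mul0r; have := key (- (C + 1)) B.
have C0 : 0 <= C := functional_sqr_ge0 dg.
rewrite A00; nra.
Qed.

Lemma functional_mul_shift_le f a : dominated f -> `|I (f \* translate a f)| <= I (f \* f).
Proof.
move=> df; have ds := dominated_shift a df.
have := functional_CauchySchwarz df ds.
have -> : I (translate a f \* translate a f) = I (f \* f) by rewrite -(Ish a (dominatedM df df)).
by rewrite -expr2 -(real_normK (num_real (I (f \* _)))) ler_pXn2r// nnegrE// functional_sqr_ge0.
Qed.

(* With u_n = <f, (l^* l)^n f> one has u_n^2 <= <f, f> u_(2n), while u_n grows
   at most polynomially in n; hence u_1 <= <f, f>. *)
Lemma convol_contraction l f : dominated f ->
  (forall n a, `|coefm (powm (mulm (starm l) l) n) a| <= 1) ->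
  I (convol l f \* convol l f) <= I (f \* f).
Proof.
move=> df hc; set d := mulm (starm l) l in hc *; set K := I (f \* f).
have K0 : 0 <= K := functional_sqr_ge0 df.
have dom n : dominated (iter n (convol d) f).
  by elim: n => //= n IH; exact: dominated_conv.
have starK : starm (starm l) = l.
  by rewrite /starm -map_comp map_id_in// => -[a b] _ /=; rewrite opprK.
have sym g h : dominated g -> dominated h ->
    I (convol d g \* h) = I (g \* convol d h).
  move=> dg dh; rewrite /d !convol_mulm functional_convol_mul//; last exact: dominated_conv.
  by rewrite starK functional_convol_mul//; exact: dominated_conv.
pose u n := I (f \* iter n (convol d) f).
(* Factors of the self-adjoint operator convol d are moved one by one to the other side of the
   form. *)
have usplit n m : u (n + m)%N = I (iter n (convol d) f \* iter m (convol d) f).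
  elim: n m => [|n IH] m //=; rewrite sym// -[convol d _]/(iter m.+1 _ f) -IH.
  by rewrite addSnnS.
have u2 n : u n ^+ 2 <= K * u (n + n)%N.
  by rewrite usplit; exact: functional_CauchySchwarz.
have u1 : I (convol l f \* convol l f) = u 1%N.
  by rewrite functional_convol_mul//; [rewrite /u /= /d convol_mulm|exact: dominated_conv].
(* Collecting atoms leaves polynomially many terms, each with coefficient at most 1 and correlation
   at most K. *)
have ubound n : u n <= K * (n.+1 ^ size d)%:R.
  rewrite /u -convol_powm.
  have -> : f \* convol (powm d n) f =
     fun x => \sum_(a <- undup (unzip2 (powm d n))) coefm (powm d n) a * (f \* translate a f) x.
    apply/funext => x; rewrite /= /convol.
    rewrite (sum_coefm _ (fun a => translate a f x)) big_distrr; apply: eq_bigr => a _.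
    by rewrite /= mulrCA.
  rewrite (functional_sum _ _ _).2; last first.
    by move=> a; apply: dominatedM => //; exact: dominated_shift.
  apply: le_trans (ler_norm _) _; apply: le_trans (ler_norm_sum _ _ _) _.
  apply: (@le_trans _ _ (\sum_(a <- undup (unzip2 (powm d n))) K)).
    apply: ler_sum => a _; rewrite normrM -[leRHS]mul1r.
    by apply: ler_pM => //; exact: functional_mul_shift_le.
  rewrite big_const_seq count_predT iter_addr_0 -[leLHS]mulr_natr.
  by apply: ler_wpM2l => //; rewrite ler_nat size_supp_powm.
rewrite u1; have u10 : 0 <= u 1%N by rewrite -u1 functional_sqr_ge0//; exact: dominated_conv.
have [K00|K00] := eqVneq K 0.
  by have := u2 1%N; rewrite K00 mul0r; nra.
have {}K0 : 0 < K by rewrite lt_neqAle eq_sym K00.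
suff : u 1%N / K <= 1 by rewrite ler_pdivrMr// mul1r.
apply: (@le1_of_poly_growth _ _ (size d)); first by rewrite divr_ge0// ltW.
move=> j; apply: (@le_trans _ _ (u (2 ^ j)%N / K)); last first.
  by rewrite ler_pdivrMr// mulrC.
(* Doubling: the squared bound at 2^j gives (u_1 / K)^(2^j) <= u_(2^j) / K. *)
elim: j => [|j IH]; first by rewrite expn0 expr1.
rewrite expnS mul2n -addnn exprD -expr2.
have uj0 : 0 <= (u 1%N / K) ^+ (2 ^ j) by rewrite exprn_ge0// divr_ge0// ltW.
apply: (@le_trans _ _ ((u (2 ^ j)%N / K) ^+ 2)).
  by rewrite ler_pXn2r// nnegrE// (le_trans uj0).
rewrite expr_div_n ler_pdivrMr ?exprn_gt0//.
rewrite [leRHS](_ : _ = K * u (2 ^ j + 2 ^ j)%N)//.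
by rewrite expr2 mulrA divfK// mulrC.
Qed.

End NormBound.
End InvariantFunctional.

(** * Real-valued modulus of complex numbers *)

Section ComplexModulus.
Context {R : realType}.
Implicit Types (z w : CC R) (a b : R).

Definition rc (a : R) : CC R := real_complex R a.

Lemma rc_le a b : (rc a <= rc b) = (a <= b). Proof. exact: lecR. Qed.
Lemma rcD a b : rc (a + b) = rc a + rc b. Proof. exact: rmorphD. Qed.
Lemma rcM a b : rc (a * b) = rc a * rc b. Proof. exact: rmorphM. Qed.
Lemma rc0 : rc 0 = 0. Proof. by []. Qed.
Lemma rc1 : rc 1 = 1. Proof. by []. Qed.
Lemma rc_sum (T : Type) (r : seq T) (Q : pred T) (F : T -> R) :
  rc (\sum_(i <- r | Q i) F i) = \sum_(i <- r | Q i) rc (F i).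
Proof. exact: rmorph_sum. Qed.

Lemma normE z : `|z| = rc (cabs z). Proof. by case: z => a b; rewrite normc_def. Qed.

Lemma norm_le1 z : (`|z| <= 1) = (cabs z <= 1).
Proof. by rewrite normE -rc1 rc_le. Qed.

Lemma cabs_ge0 z : 0 <= cabs z.
Proof. by case: z => a b; exact: sqrtr_ge0. Qed.
Lemma cabsM z w : cabs (z * w) = cabs z * cabs w.
Proof. exact: ComplexField.Normc.normcM. Qed.
Lemma cabs0 : cabs (0 : CC R) = 0. Proof. exact: ComplexField.Normc.normc0. Qed.
Lemma cabs1 : cabs (1 : CC R) = 1. Proof. exact: ComplexField.Normc.normc1. Qed.
Lemma cabsN z : cabs (- z) = cabs z.
Proof. exact: normcN. Qed.
Lemma cabsD z w : cabs (z + w) <= cabs z + cabs w.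
Proof. by rewrite -rc_le rcD -!normE; exact: ler_normD. Qed.
Lemma cabsB z w : cabs (z - w) <= cabs z + cabs w.
Proof. by rewrite -(cabsN w); exact: cabsD. Qed.
Lemma cabs_distC z w : cabs (z - w) = cabs (w - z).
Proof. by rewrite -cabsN opprB. Qed.
Lemma cabs_rc a : cabs (rc a) = `|a|.
Proof. by rewrite /cabs /= expr0n/= addr0 sqrtr_sqr. Qed.
Lemma cabs0_eq0 z : cabs z = 0 -> z = 0.
Proof. exact: ComplexField.Normc.eq0_normc. Qed.
Lemma cabs_sum (T : Type) (r : seq T) (F : T -> CC R) :
  cabs (\sum_(i <- r) F i) <= \sum_(i <- r) cabs (F i).
Proof.
elim: r => [|i r IH]; first by rewrite !big_nil cabs0.
by rewrite !big_cons; apply: le_trans (cabsD _ _) _; rewrite lerD2l.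
Qed.
Lemma cabs_conj z : cabs (z^*) = cabs z.
Proof. by have := norm_conjC z; rewrite !normE => -[]. Qed.
Lemma rc_conj a : (rc a)^* = rc a.
Proof. by rewrite conj_Creal// realE -rc0 !rc_le; exact: le_total. Qed.
Lemma cabsX z n : cabs (z ^+ n) = cabs z ^+ n.
Proof. by elim: n => [|n IH]; rewrite ?cabs1// !exprS cabsM IH. Qed.
Lemma cabsV z : cabs z^-1 = (cabs z)^-1.
Proof. exact: ComplexField.Normc.normcV. Qed.

End ComplexModulus.

(** * Characters and window norms *)

Section DualGroup.
Context {R : realType} {G : topologicalZmodType}.
Local Notation C := (CC R).
Local Notation Gam := (dual R G).
Implicit Types (g h : Gam) (x y : G).

Lemma character_eq g h : (forall x, chf g x = chf h x) -> g = h.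
Proof.
case: g => f hf; case: h => f' hf' /= e.
have {}e : f = f' by apply/funext.
by rewrite e in hf *; congr Character; exact: Prop_irrelevance.
Qed.

Lemma chf_norm g x : `|chf g x| = 1. Proof. by have [_ ->] := chP g. Qed.
Lemma chfD g x y : chf g (x + y) = chf g x * chf g y.
Proof. by have [_ _ ->] := chP g. Qed.
Lemma chf_cabs g x : cabs (chf g x) = 1.
Proof. by have := chf_norm g x; rewrite normE -rc1 => -[]. Qed.
Lemma chf_neq0 g x : chf g x != 0.
Proof. by rewrite -normr_eq0 chf_norm oner_eq0. Qed.
Lemma chf0 g : chf g 0 = 1.
Proof. by apply: (mulfI (chf_neq0 g 0)); rewrite -chfD addr0 mulr1. Qed.
Lemma chfN g x : chf g (- x) = (chf g x)^-1.
Proof. by apply: (mulfI (chf_neq0 g x)); rewrite -chfD subrr chf0 mulfV// chf_neq0. Qed.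
Lemma chf_conj g x : (chf g x)^* = chf g (- x).
Proof. by rewrite chfN invC_norm chf_norm expr1n invr1 mul1r. Qed.
Lemma chfMn g x n : chf g (x *+ n) = chf g x ^+ n.
Proof. by elim: n => [|n IH]; rewrite ?mulr0n ?chf0// mulrS chfD IH exprS. Qed.

Lemma dual_addA : associative (@chadd R G).
Proof. by move=> a b c; apply: character_eq => x /=; rewrite mulrA. Qed.
Lemma dual_addC : commutative (@chadd R G).
Proof. by move=> a b; apply: character_eq => x /=; rewrite mulrC. Qed.
Lemma dual_add0 : left_id (@ch0 R G) (@chadd R G).
Proof. by move=> a; apply: character_eq => x /=; rewrite mul1r. Qed.
Lemma dual_addN : left_inverse (@ch0 R G) (@chopp R G) (@chadd R G).
Proof. by move=> a; apply: character_eq => x /=; rewrite chfN mulVf// chf_neq0. Qed.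

(** With pointwise multiplication as addition, the dual becomes a [zmodType] to which the results on
    measures and invariant functionals apply. *)
HB.instance Definition _ := Choice.copy Gam (@character R G).
HB.instance Definition _ := GRing.isZmodule.Build Gam
  dual_addA dual_addC dual_add0 dual_addN.

Lemma chDf g h x : chf (g + h) x = chf g x * chf h x. Proof. by []. Qed.
Lemma chNf g x : chf (- g) x = (chf g x)^-1. Proof. exact: chfN. Qed.
Lemma ch0f x : chf (0 : Gam) x = 1. Proof. by []. Qed.

(** The inequality norm <= M, free of suprema in the extended reals and for an arbitrary set of
    frequencies instead of a window. *)
Definition bounded_on (E : set Gam) (f : Gam -> C) (M : R) :=
  forall s c, span_unit_ball E s c -> cabs (\sum_(h <- s) c h * f h) <= M.

Lemma chtranslateE (E : set Gam) g h : chtranslate E g h <-> E (h - g).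
Proof.
split=> [[e Ee <-]|Eh]; first by rewrite -[chadd e g]/(e + g) addrK.
by exists (h - g) => //; rewrite -[chadd _ _]/(h - g + g) subrK.
Qed.

Section BoundedOn.
Implicit Types (E : set Gam) (f k : Gam -> C) (M : R).

Lemma bounded_on_ge0 E f M : bounded_on E f M -> 0 <= M.
Proof.
move=> /(_ [::] (fun=> 0)); rewrite big_nil cabs0; apply.
by split => // x; rewrite /trig_poly big_nil normr0 ler01.
Qed.

Lemma bounded_on_eq E f k M : (forall h, E h -> f h = k h) ->
  bounded_on E f M -> bounded_on E k M.
Proof.
move=> fk fM s c sc; have [_ sE _] := sc; have := fM s c sc.
suff -> : \sum_(h <- s) c h * f h = \sum_(h <- s) c h * k h by [].
by apply: eq_big_seq => h /sE/fk ->.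
Qed.

Lemma bounded_on_sub E E' f M : E `<=` E' -> bounded_on E' f M -> bounded_on E f M.
Proof. by move=> EE fM s c [u sE n]; apply: fM; split => // h /sE/EE. Qed.

Lemma bounded_on_le E f M M' : M <= M' -> bounded_on E f M -> bounded_on E f M'.
Proof. by move=> MM fM s c sc; exact: le_trans (fM s c sc) MM. Qed.

Lemma bounded_onD E f k M M' : bounded_on E f M -> bounded_on E k M' ->
  bounded_on E (f \+ k) (M + M').
Proof.
move=> fM kM s c sc; under eq_bigr do rewrite mulrDr.
by rewrite big_split; apply: le_trans (cabsD _ _) _; apply: lerD; [exact: fM|exact: kM].
Qed.

Lemma bounded_onZ E (a : C) f M : bounded_on E f M ->
  bounded_on E (fun h => a * f h) (cabs a * M).
Proof.
move=> fM s c sc; under eq_bigr do rewrite mulrCA.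
by rewrite -big_distrr cabsM ler_wpM2l ?cabs_ge0//; exact: fM.
Qed.

Lemma bounded_onB E f k M M' : bounded_on E f M -> bounded_on E k M' ->
  bounded_on E (f \- k) (M + M').
Proof.
move=> fM kM; have := bounded_onD fM (bounded_onZ (-1) kM).
rewrite cabsN cabs1 mul1r; apply: bounded_on_eq => h _ /=.
by rewrite mulN1r.
Qed.

Lemma bounded_on0 E : bounded_on E (fun=> 0) 0.
Proof. by move=> s c _; rewrite big1 ?cabs0// => h _; rewrite mulr0. Qed.

Lemma bounded_on1 E : bounded_on E (fun=> 1) 1.
Proof.
move=> s c [_ _ /(_ 0)]; rewrite norm_le1 /trig_poly.
by under eq_bigr do rewrite chf0.
Qed.

Lemma bounded_on_scale E f M s c K : bounded_on E f M -> uniq s ->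
  (forall h, h \in s -> E h) -> (forall x, cabs (trig_poly s c x) <= K) ->
  cabs (\sum_(h <- s) c h * f h) <= K * M.
Proof.
move=> fM us sE PK; have M0 := bounded_on_ge0 fM.
have K0 : 0 <= K := le_trans (cabs_ge0 _) (PK 0).
(* Since K may be 0, the coefficients are normalized by a larger K', and K' then tends to K. *)
have key K' : K < K' -> cabs (\sum_(h <- s) c h * f h) <= K' * M.
  move=> KK; have K'0 : 0 < K' := le_lt_trans K0 KK.
  have cK : cabs (rc K'^-1) = K'^-1 by rewrite cabs_rc ger0_norm// invr_ge0 ltW.
  rewrite -ler_pdivrMl// -cK -cabsM big_distrr /=.
  under eq_bigr do rewrite mulrA.
  apply: fM (fun h => rc K'^-1 * c h) _; split => // x; rewrite norm_le1 /trig_poly.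
  under eq_bigr do rewrite -mulrA.
  rewrite -big_distrr cabsM cK /= ler_pdivrMl// mulr1.
  exact: le_trans (PK x) (ltW KK).
apply/ler_addgt0Pr => e e0; have M1 : 0 < M + 1 by lra.
have := key (K + e / (M + 1)); rewrite ltrDl divr_gt0// => /(_ isT) h.
apply: le_trans h _; rewrite mulrDl lerD2l mulrAC ler_pdivrMr//.
by rewrite ler_wpM2l ?ltW// ltrDl.
Qed.

(** For each x, the translate y -> P (x + y) has coefficients c h h(x) and stays in the unit ball.
    So the polynomial with coefficients c h f h has modulus at most M everywhere, and [k] is tested
    on it. *)
Lemma bounded_onM E f k M M' : bounded_on E f M -> bounded_on E k M' ->
  bounded_on E (f \* k) (M * M').
Proof.
move=> fM kM s c [us sE P1]; under eq_bigr do rewrite mulrA.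
apply: (bounded_on_scale (c := fun h => c h * f h) kM) => // x.
rewrite /trig_poly; under eq_bigr do rewrite mulrAC.
apply: (fM s (fun h => c h * chf h x)); split => // y.
rewrite /trig_poly; under eq_bigr do rewrite -mulrA -chfD.
exact: P1.
Qed.

Lemma bounded_on_pt E f M h : E h -> bounded_on E f M -> cabs (f h) <= M.
Proof.
move=> Eh /(_ [:: h] (fun=> 1)); rewrite big_seq1 mul1r; apply; split => //.
  by move=> h'; rewrite inE => /eqP ->.
by move=> x; rewrite /trig_poly big_seq1 mul1r chf_norm.
Qed.

(** Multiplying a polynomial by a character shifts its frequencies and keeps its modulus. *)
Lemma bounded_on_shift E f M g : bounded_on [set h | E (h + g)] f M ->
  bounded_on E (fun h => f (h - g)) M.
Proof.
move=> fM s c [us sE P1].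
have := fM [seq h - g | h <- s] (fun h => c (h + g)); rewrite big_map.
under eq_bigr do rewrite subrK.
apply; split.
- by rewrite map_inj_uniq//; exact: addIr.
- by move=> _ /mapP[h /sE ? ->] /=; rewrite subrK.
move=> x; rewrite /trig_poly big_map.
under eq_bigr do rewrite subrK chDf mulrA.
rewrite -big_distrl normrM chf_norm mulr1; exact: P1.
Qed.

End BoundedOn.

(** * From bounds on windows to the norms of the statement *)

Section BseNorm.
Variable Vb : set Gam.
Implicit Types (f : Gam -> C) (M : R).

Lemma bse_norm_at_le g f M : (bse_norm_at Vb g f <= M%:E)%E <->
  bounded_on (chtranslate Vb g) f M.
Proof.
split=> [h s c sc|h].
  rewrite -lee_fin; apply: le_trans h; apply: ereal_sup_ubound.
  by exists s, c.
by apply: ge_ereal_sup => _ [s [c [sc ->]]]; rewrite lee_fin; exact: h.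
Qed.

Lemma bse_norm_le f M : (bse_norm Vb f <= M%:E)%E <->
  forall g, bounded_on (chtranslate Vb g) f M.
Proof.
split=> [h g|h].
  by apply/bse_norm_at_le; apply: le_trans h; apply: ereal_sup_ubound; exists g.
by apply: ge_ereal_sup => _ [g _ <-]; exact/bse_norm_at_le.
Qed.

Lemma bse_norm_ge0 f : (0 <= bse_norm Vb f)%E.
Proof.
apply: (@le_trans _ _ (bse_norm_at Vb 0 f)); last first.
  by apply: ereal_sup_ubound; exists 0.
apply: ereal_sup_ubound; exists [::], (fun=> 0); split; last by rewrite big_nil cabs0.
by split => // x; rewrite /trig_poly big_nil normr0 ler01.
Qed.

Lemma bse_normR_bound f : (bse_norm Vb f < +oo)%E ->
  forall g, bounded_on (chtranslate Vb g) f (bse_normR Vb f).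
Proof.
move=> foo; apply/bse_norm_le; rewrite /bse_normR fineK//.
by rewrite ge0_fin_numE// bse_norm_ge0.
Qed.

Lemma bse_normR_le f M : (forall g, bounded_on (chtranslate Vb g) f M) ->
  bse_normR Vb f <= M.
Proof.
move=> /bse_norm_le h; rewrite -lee_fin /bse_normR fineK//.
by rewrite ge0_fin_numE ?bse_norm_ge0// (le_lt_trans h)// ltry.
Qed.

End BseNorm.

(** * Coefficients of trigonometric polynomials and of measures *)

Section Coefficients.

(* Averaging [x |-> g^-1 P] over the multiples of a point [y] where the characters
   [h] and [g] differ makes the [h]-coefficient as small as desired. *)
Lemma coefficient_bound_aux g (t : seq Gam) : g \notin t ->
  forall (c : Gam -> C) (a : C) (K : R),
  (forall x, cabs (a * chf g x + \sum_(h <- t) c h * chf h x) <= K) -> cabs a <= K.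
Proof.
elim: t => [|h t IH] gt c a K PK.
  by have := PK 0; rewrite big_nil addr0 chf0 mulr1.
have [gh {}gt] : g <> h /\ g \notin t.
  by move: gt; rewrite inE negb_or => /andP[/eqP].
have [y hy] : exists y, chf h y != chf g y.
  apply: contrapT => ny; apply: gh; apply: character_eq => x.
  by apply/eqP/negPn/negP => nx; apply: ny; exists x; rewrite eq_sym.
pose z (k : Gam) := chf (k - g) y.
have zn k : cabs (z k) = 1 by rewrite chf_cabs.
have z1 : z h - 1 != 0.
  by rewrite subr_eq0 /z chDf chNf; apply: contraNneq hy => /divr1_eq ->.
have d0 : 0 < cabs (z h - 1).
  by rewrite lt_neqAle cabs_ge0 andbT eq_sym; apply: contra_neq z1; exact: cabs0_eq0.
apply/ler_addgt0Pr => e e0.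
have [n hn] : exists n : nat, (cabs (c h) * 2 / cabs (z h - 1)) / e < n%:R.
  by eexists; exact: truncnS_gt.
have n0 : 0 < n%:R :> R.
  apply: le_lt_trans hn; apply: divr_ge0; last exact: ltW.
  by rewrite divr_ge0 ?cabs_ge0// mulr_ge0 ?cabs_ge0.
have nC : n%:R != 0 :> C by rewrite pnatr_eq0 -(pnatr_eq0 R) gt_eqF.
have cn : cabs (n%:R : C) = n%:R.
  rewrite (_ : n%:R = rc n%:R); last by rewrite /rc rmorph_nat.
  by rewrite cabs_rc ger0_norm.
(* Averaging multiplies the coefficient at k by m k. Here m g = 1, while m h is a geometric mean of
   modulus at most 2 / (n |z h - 1|). *)
pose m (k : Gam) := n%:R^-1 * \sum_(j < n) z k ^+ j.
have mg : m g = 1.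
  rewrite /m /z; under eq_bigr do rewrite subrr ch0f expr1n.
  by rewrite sumr_const card_ord mulVf.
have mh : cabs (c h * m h) <= e.
  have : (z h - 1) * \sum_(j < n) z h ^+ j = z h ^+ n - 1 by rewrite -subrX1.
  move/(congr1 cabs); rewrite cabsM => e1.
  have e2 : cabs (z h - 1) * cabs (\sum_(j < n) z h ^+ j) <= 2.
    by rewrite e1; apply: le_trans (cabsB _ _) _; rewrite cabsX zn expr1n cabs1.
  rewrite /m !cabsM cabsV cn mulrCA -ler_pdivlMl ?invr_gt0// invrK.
  move: hn; rewrite ltr_pdivrMr// => /ltW; apply: le_trans.
  rewrite -mulrA ler_wpM2l ?cabs_ge0//.
  by rewrite ler_pdivlMr// mulrC.
(* Removing the [h] term, of modulus at most e, costs e: the induction runs with K + e. *)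
apply: (IH gt (fun k => c k * m k)) => x.
have avg : a * chf g x + \sum_(k <- h :: t) c k * m k * chf k x =
   n%:R^-1 * \sum_(j < n) (chf g (y *+ j))^-1 *
     (a * chf g (x + y *+ j) + \sum_(k <- h :: t) c k * chf k (x + y *+ j)).
  have term k (b : C) : n%:R^-1 * \sum_(j < n) (chf g (y *+ j))^-1 * (b * chf k (x + y *+ j))
      = b * m k * chf k x.
    rewrite /m mulrAC [RHS]mulrCA; congr (_ * _); rewrite big_distrr /=.
    apply: eq_bigr => j _; rewrite chfD !chfMn /z chDf chNf exprMn exprVn.
    by rewrite mulrC -!mulrA.
  under [X in _ = _ * X]eq_bigr do rewrite mulrDr big_distrr /=.
  rewrite big_split /= mulrDr term mg mulr1; congr (_ + _).
  rewrite exchange_big /= big_distrr /=; apply: eq_bigr => k _.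
  by rewrite term.
have : cabs (a * chf g x + \sum_(k <- h :: t) c k * m k * chf k x) <= K.
  rewrite avg cabsM cabsV cn ler_pdivrMl//; apply: le_trans (cabs_sum _ _) _.
  apply: (@le_trans _ _ (\sum_(j < n) K)).
    by apply: ler_sum => j _; rewrite cabsM cabsV chf_cabs invr1 mul1r.
  by rewrite sumr_const card_ord -[leLHS]mulr_natl.
rewrite big_cons addrCA => h1.
set u := a * _ + _ in h1 *.
have -> : u = (c h * m h * chf h x + u) - c h * m h * chf h x by ring.
by apply: le_trans (cabsB _ _) _; rewrite [cabs (_ * chf h x)]cabsM chf_cabs mulr1 lerD.
Qed.

Lemma coefficient_bound (s : seq Gam) (c : Gam -> C) (K : R) g : uniq s -> g \in s ->
  (forall x, cabs (trig_poly s c x) <= K) -> cabs (c g) <= K.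
Proof.
move=> us gs PK; apply: (@coefficient_bound_aux g (rem g s) _ c) => [|x].
  by rewrite mem_rem_uniqF.
have := PK x; rewrite /trig_poly (perm_big _ (perm_to_rem gs)) big_cons.
by [].
Qed.

(** The Fourier transform of a measure on the dual; it turns [mulm] into products and [starm] into
    conjugation. *)
Definition evalm (l : seq (R * Gam)) (x : G) : C := \sum_(a <- l) rc a.1 * chf a.2 x.

Lemma evalm_mulm l1 l2 x : evalm (mulm l1 l2) x = evalm l1 x * evalm l2 x.
Proof.
rewrite /evalm big_allpairs_dep big_distrl; apply: eq_bigr => a _ /=.
rewrite big_distrr; apply: eq_bigr => b _ /=.
by rewrite rcM mulrACA.
Qed.

Lemma evalm_powm l n x : evalm (powm l n) x = evalm l x ^+ n.
Proof.
elim: n => [|n IH] /=; first by rewrite /evalm big_seq1 rc1 ch0f mulr1.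
by rewrite evalm_mulm IH exprS.
Qed.

Lemma evalm_starm l x : evalm (starm l) x = (evalm l x)^*.
Proof.
rewrite /evalm big_map rmorph_sum; apply: eq_bigr => a _ /=.
by rewrite rmorphM /= chf_conj; congr (_ * _); rewrite rc_conj.
Qed.

Lemma coefm_bound (l : seq (R * Gam)) (K : R) g : 0 <= K ->
  (forall x, cabs (evalm l x) <= K) -> `|coefm l g| <= K.
Proof.
move=> K0 PK; rewrite -cabs_rc.
have [gl|gl] := boolP (g \in undup (unzip2 l)); last first.
  rewrite /coefm big_seq_cond big1 ?rc0 ?cabs0// => a /andP[al /eqP ag].
  by move: gl; rewrite mem_undup -ag map_f.
apply: (coefficient_bound (c := fun h => rc (coefm l h)) (undup_uniq _) gl) => x.
have := PK x; suff -> : evalm l x = trig_poly (undup (unzip2 l)) (fun h => rc (coefm l h)) x by [].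
rewrite /evalm /trig_poly /coefm.
under [RHS]eq_bigr do rewrite rc_sum big_distrl /=.
rewrite (exchange_big_dep xpredT) //= big_seq [RHS]big_seq; apply: eq_bigr => a al.
rewrite -big_filter (_ : [seq _ <- _ | _] = [:: a.2]) ?big_seq1//.
rewrite (eq_filter (a2 := pred1 a.2)); last by move=> y /=; rewrite eq_sym.
by rewrite filter_pred1_uniq ?undup_uniq// mem_undup map_f.
Qed.

End Coefficients.
End DualGroup.
Arguments bounded_on1 {R G} E [s c] _.
Arguments bounded_on0 {R G} E [s c] _.

(** * Norm bound for correlations I (m k(. - g)) *)

Section CorrelationBound.
Context {R : realType} {G : topologicalZmodType}.
Local Notation C := (CC R).
Local Notation Gam := (dual R G).
Variables (P : set Gam) (I : (Gam -> R) -> R).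
Hypothesis HI : invariant_functional P I.

(* Multiplying by a unimodular constant and taking real parts of the coefficients
   reduces the estimate to real measures, where [convol_contraction] applies. *)
Lemma bounded_on_correlation (m k : Gam -> R) : dominated P m -> dominated P k ->
  bounded_on setT (fun g => rc (I (m \* translate g k)) : C)
    (Num.sqrt (I (k \* k) * I (m \* m))).
Proof.
move=> dm dk s c [us _ P1]; set w := \sum_(h <- s) _.
have [w0|w0] := eqVneq w 0; first by rewrite w0 cabs0 sqrtr_ge0.
have cw0 : cabs w != 0 by apply: contra_neq w0; exact: cabs0_eq0.
pose u : C := rc (cabs w)^-1 * w^*.
have cu : cabs u = 1.
  by rewrite cabsM cabs_conj cabs_rc ger0_norm ?invr_ge0 ?cabs_ge0// mulVf.
have uw : u * w = rc (cabs w).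
  rewrite /u -mulrA [w^* * w]mulrC -normCK normE -!rmorphXn -rmorphM /= -/(rc _).
  by congr rc; rewrite expr2 mulrA mulVf// mul1r.
clearbody u.
pose r h : R := complex.Re (u * c h).
have rE h : rc (r h) = (u * c h + (u * c h)^*) / 2.
  by rewrite /r /rc ReJ_add.
pose l := [seq (r h, h) | h <- s].
have Pl x : cabs (evalm l x) <= 1.
  (* Since h(x) is the conjugate of h(- x), taking real parts of the coefficients averages u P(x)
     with the conjugate of u P(- x). *)
  have -> : evalm l x = (u * trig_poly s c x + (u * trig_poly s c (- x))^*) / 2.
    rewrite /evalm big_map /trig_poly !big_distrr /= rmorph_sum /= -big_split /=.
    rewrite big_distrl /=; apply: eq_bigr => h _.
    rewrite rE !rmorphM /= chf_conj opprK; ring.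
  rewrite cabsM cabsV (_ : cabs 2 = 2); last first.
    by rewrite (_ : 2 = rc 2) ?cabs_rc ?ger0_norm// /rc rmorph_nat.
  rewrite ler_pdivrMr// mul1r; apply: le_trans (cabsD _ _) _.
  rewrite cabs_conj !cabsM cu !mul1r.
  have := P1 x; have := P1 (- x); rewrite !norm_le1; lra.
have Pd x : cabs (evalm (mulm (starm l) l) x) <= 1.
  by rewrite evalm_mulm evalm_starm cabsM cabs_conj mulr_ile1 ?cabs_ge0.
have contr : I (convol l k \* convol l k) <= I (k \* k).
  apply: (convol_contraction HI) => // n a; apply: coefm_bound => // x.
  by rewrite evalm_powm cabsX exprn_ile1 ?cabs_ge0.
have wE : cabs w = I (m \* convol l k).
  have -> : m \* convol l k = fun x => \sum_(h <- s) r h * (m \* translate h k) x.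
    apply/funext => x; rewrite /= /convol big_map big_distrr; apply: eq_bigr => h _ /=.
    by rewrite mulrCA.
  rewrite (functional_sum HI _ _ _).2; last first.
    by move=> h; apply: dominatedM => //; exact: dominated_shift.
  have := congr1 (@complex.Re R) uw; rewrite /= => <-.
  rewrite /w big_distrr raddf_sum /=; apply: eq_bigr => h _.
  rewrite /r mulrA; case: (u * c h) => a b /=; ring.
have dl := dominated_conv l dk.
rewrite -(ger0_norm (cabs_ge0 w)) -sqrtr_sqr ler_wsqrtr// wE.
apply: le_trans (functional_CauchySchwarz HI dm dl) _.
by rewrite mulrC ler_wpM2r// (functional_sqr_ge0 HI).
Qed.

End CorrelationBound.

(** * The topology of the dual group *)

Section DualTopology.
Context {R : realType} {G : topologicalZmodType}.
Local Notation C := (CC R).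
Local Notation Gam := (dual R G).
Implicit Types (g h : Gam) (K : set G) (U : set Gam).

Definition close_on K (e : R) (f f' : G -> C) := forall x, K x -> cabs (f' x - f x) < e.

(** Neighbourhoods for uniform convergence on compact sets, to be compared with the compact-open
    topology. *)
Definition close_filter (f : G -> C) : set_system (G -> C) :=
  [set A | exists K (e : R), [/\ compact K, 0 < e & forall f', close_on K e f f' -> A f']].

Lemma close_filter_filter (f : G -> C) : Filter (close_filter f).
Proof.
split.
- by exists set0, 1; split => //; exact: compact0.
- move=> A B [K [e [cK e0 KA]]] [K' [e' [cK' e'0 KB]]].
  exists (K `|` K'), (Num.min e e'); split.
  + exact: compactU.
  + by rewrite lt_min e0.
  + move=> f' h; split; [apply: KA|apply: KB] => x Kx.
      by have := h x (or_introl Kx); rewrite lt_min => /andP[].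
    by have := h x (or_intror Kx); rewrite lt_min => /andP[].
- move=> A B AB [K [e [cK e0 KA]]]; exists K, e; split => // f' /KA; exact: AB.
Qed.

Lemma entourage_cabs (E : set (C * C)) : entourage E <->
  exists2 e : R, 0 < e & forall z w, cabs (w - z) < e -> E (z, w).
Proof.
rewrite -entourage_ballE; split.
  (* Radii of balls are positive elements of the complex field, hence real. *)
  case=> e /= e0 sub; have /andP[/eqP ie0 re0] : (complex.Im e == 0) && (0 < complex.Re e).
    by move: e0; rewrite ltcE.
  exists (complex.Re e) => // z w zw; apply: sub; rewrite /= /ball /= distrC.
  rewrite normE; move: zw; case: e e0 ie0 re0 => a b /= _ -> _ zw.
  by rewrite ltcR.
case=> e e0 sub; exists (rc e); first by rewrite /= -rc0 ltcR.
by case=> z w; rewrite /= /ball /= distrC normE ltcR => /sub.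
Qed.

Lemma dual_nbhsP g U : nbhs g U <->
  exists K e, [/\ compact K, 0 < e &
    forall h, close_on K e (chf g) (chf h) -> U h].
Proof.
have [cg _ _] := chP g.
split.
  case=> _ [[W oW <-] Wg sub].
  have FF := close_filter_filter (chf g).
  have cvg : {compact-open, close_filter (chf g) --> chf g}.
    apply/(compact_open_fam_compactP cg FF); apply/fam_cvgP => K cK B.
    move=> /uniform_nbhs[E [/entourage_cabs[e e0 eE] EB]].
    exists K, e; split => // f' ff'; apply: EB => x Kx; apply: eE; exact: ff'.
  have [K [e [cK e0 KW]]] : close_filter (chf g) W.
    by apply: cvg; apply: open_nbhs_nbhs.
  by exists K, e; split => // h /KW Wh; exact: sub.
case=> K [e [cK e0 KU]].
pose F : set_system (G -> C) := nbhs (chf g : {compact-open, G -> C}).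
have FF : Filter F by exact: (@nbhs_filter {compact-open, G -> C}).
have Fg : {compact-open, F --> chf g} by [].
move/(compact_open_fam_compactP cg FF) : Fg => /fam_cvgP/(_ K cK) cvgK.
have F0 : nbhs (chf g : {compact-open, G -> C}) [set f | close_on K e (chf g) f].
  apply: cvgK; apply/uniform_nbhs; exists [set zw | cabs (zw.2 - zw.1) < e].
  by split => //; apply/entourage_cabs; exists e.
have : nbhs g [set h : Gam | close_on K e (chf g) (chf h)].
  exact: (@initial_continuous _ _ (fun k : character => (chf k : {compact-open, G -> C})) g _ F0).
by apply: filterS => h; exact: KU.
Qed.

Lemma continuousP_cabs (T : topologicalType) (f : T -> C) : continuous f <->
  forall t (e : R), 0 < e -> \forall t' \near t, cabs (f t' - f t) < e.
Proof.
split=> [cf t e e0|h t A].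
  have : nbhs (f t) [set z | cabs (z - f t) < e].
    apply/nbhs_ballP; exists (rc e); first by rewrite /= -rc0 ltcR.
    by move=> z; rewrite /ball /= distrC normE ltcR.
  by move/cf.
move=> /nbhs_ballP[e /= e0 sub].
have /andP[/eqP ie0 re0] : (complex.Im e == 0) && (0 < complex.Re e).
  by move: e0; rewrite ltcE.
have := h t _ re0; apply: filterS => t' zw; apply: sub.
rewrite /ball /= distrC normE; move: zw; case: e e0 ie0 re0 => a b /= _ -> _ zw.
by rewrite ltcR.
Qed.

Lemma dual_shift_continuous g : continuous (fun h : Gam => h + g).
Proof.
move=> h U /dual_nbhsP[K [e [cK e0 KU]]]; apply/dual_nbhsP; exists K, e; split => // h' hh'.
apply: KU => x Kx; rewrite !chDf -mulrBl cabsM chf_cabs mulr1; exact: hh'.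
Qed.

Lemma nbhs_shift g U : nbhs g U <-> nbhs (0 : Gam) [set h | U (h + g)].
Proof.
split=> [Ug|U0].
  by apply: (dual_shift_continuous (g := g)); rewrite add0r.
have nb : nbhs g [set h | U (h - g + g)].
  by apply: (@dual_shift_continuous (- g) g [set h | U (h + g)]); rewrite subrr.
by apply: filterS nb => h /=; rewrite subrK.
Qed.

Lemma nbhs0_split U : nbhs (0 : Gam) U -> exists2 W : set Gam, nbhs (0 : Gam) W &
  [/\ W `<=` U, (forall g, W g -> W (- g)) & forall g h, W g -> W h -> U (g + h)].
Proof.
move=> /dual_nbhsP[K [e [cK e0 KU]]].
exists [set g | close_on K (e / 2) (chf (0 : Gam)) (chf g)].
  by apply/dual_nbhsP; exists K, (e / 2); split => //; rewrite divr_gt0.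
split.
- move=> g hg; apply: KU => x Kx; apply: lt_trans (hg x Kx) _; lra.
- move=> g hg x Kx; rewrite ch0f chNf.
  have -> : (chf g x)^-1 - 1 = (chf g x)^-1 * (1 - chf g x) by field; exact: chf_neq0.
  rewrite cabsM cabsV chf_cabs invr1 mul1r cabs_distC.
  by have := hg x Kx; rewrite ch0f.
- move=> g h hg hh; apply: KU => x Kx; rewrite chDf ch0f.
  have -> : chf g x * chf h x - 1 = chf g x * (chf h x - 1) + (chf g x - 1) by ring.
  apply: le_lt_trans (cabsD _ _) _; rewrite cabsM chf_cabs mul1r.
  by have := hg x Kx; have := hh x Kx; rewrite !ch0f; lra.
Qed.

(* The bump is [max 0 (1 - e^-1 sup_K |g - 1|)]. *)
Lemma exists_uniform_bump U : nbhs (0 : Gam) U -> exists k : Gam -> R,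
  [/\ forall g, 0 <= k g <= 1, forall g, k g != 0 -> U g,
      nbhs (0 : Gam) [set g | 1 / 2 <= k g] &
      forall g (e : R), 0 < e -> \forall g' \near g, forall h, `|k (h - g') - k (h - g)| <= e].
Proof.
move=> /dual_nbhsP[K [e [cK e0 KU]]].
(* The point 0 is added so that the supremum [d] is also correct for an empty [K]. *)
pose D g := [set cabs (chf g x - 1) | x in K] `|` [set 0].
pose d g := sup (D g).
have D0 g : D g !=set0 by exists 0; right.
have Dub g : has_ubound (D g).
  exists 2 => _ [[x Kx <-]|->//]; apply: le_trans (cabsB _ _) _.
  by rewrite chf_cabs cabs1.
have dge g x : K x -> cabs (chf g x - 1) <= d g.
  by move=> Kx; apply: ub_le_sup => //; left; exists x.
have d_ge0 g : 0 <= d g by apply: ub_le_sup => //; right.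
have dle g (M : R) : 0 <= M -> (forall x, K x -> cabs (chf g x - 1) <= M) -> d g <= M.
  by move=> M0 h; apply: ge_sup => // _ [[x Kx <-]|->//]; exact: h.
have d_tri g h : d g <= d h + d (g - h).
  apply: dle => [|x Kx]; first by rewrite addr_ge0.
  have -> : chf g x - 1 = chf h x * (chf (g - h) x - 1) + (chf h x - 1).
    rewrite chDf chNf; field; exact: chf_neq0.
  apply: le_trans (cabsD _ _) _; rewrite cabsM chf_cabs mul1r addrC.
  by rewrite lerD// dge.
have dN g : d (- g) <= d g.
  apply: dle => // x Kx; apply: le_trans (dge _ _ Kx).
  have -> : chf (- g) x - 1 = - (chf (- g) x * (chf g x - 1)).
    rewrite chNf; field; exact: chf_neq0.
  by rewrite cabsN cabsM chf_cabs mul1r.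
have dB g h : `|d g - d h| <= d (g - h).
  have := d_tri g h; have := d_tri h g; have := dN (g - h); rewrite opprB.
  by rewrite ler_norml; lra.
have dnbhs (r : R) : 0 < r -> nbhs (0 : Gam) [set g | d g <= r].
  move=> r0; apply/dual_nbhsP; exists K, r; split => // h hh /=; apply: dle; first exact: ltW.
  by move=> x Kx; have := hh x Kx; rewrite ch0f => /ltW.
pose k g := Num.max 0 (1 - d g / e).
exists k; split.
- move=> g; rewrite le_max lexx ge_max ler01 /= gerBl.
  by rewrite divr_ge0// ltW.
- move=> g kg; apply: KU => x Kx; rewrite ch0f; apply: le_lt_trans (dge _ _ Kx) _.
  rewrite ltNge; apply: contra kg => ed; apply/eqP/max_l.
  by rewrite subr_le0 ler_pdivlMr// mul1r.
- have e2 : 0 < e / 2 by rewrite divr_gt0.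
  apply: filterS (dnbhs _ e2) => g /= dg; rewrite le_max; apply/orP; right.
  rewrite lerBrDl -lerBrDr ler_pdivrMr//; apply: le_trans dg _; rewrite -[leLHS]mulrC; lra.
move=> g r r0.
have re : 0 < r * e by rewrite mulr_gt0.
have nb0 := dnbhs _ re; have : nbhs g [set g' | d (g' - g) <= r * e].
  apply/nbhs_shift; apply: filterS nb0 => h /=; by rewrite addrK.
move=> nb; near=> g' => h.
have dg' : d (g' - g) <= r * e by near: g'; exact: nb.
(* [k] is Lipschitz with constant 1 / e for the invariant length [d], so the estimate is uniform in
   h. *)
have kdist a b : `|k a - k b| <= d (a - b) / e.
  have : `|d a / e - d b / e| <= d (a - b) / e.
    by rewrite -mulrBl normrM [X in _ * X]ger0_norm ?invr_ge0 ?(ltW e0)//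
      ler_wpM2r ?dB ?invr_ge0 ?(ltW e0).
  rewrite /k; move: (d a / e) (d b / e) (d (a - b) / e) => x y z.
  by case: (leP 0 (1 - x)) => ?; case: (leP 0 (1 - y)) => ?; rewrite !ler_norml =>
    /andP[? ?]; apply/andP; split; lra.
apply: le_trans (kdist _ _) _; rewrite ler_pdivrMr//; apply: le_trans dg'.
have -> : h - g' - (h - g) = - (g' - g) by rewrite !opprB addrC addrA subrK.
exact: dN.
Unshelve. all: by end_near. Qed.

End DualTopology.

(** * Bounded approximate units *)

Section Units.
Context {R : realType} {G : topologicalZmodType}.
Local Notation C := (CC R).
Local Notation Gam := (dual R G).
Variable V : set Gam.
Hypotheses (Vo : open V) (V0 : V 0) (Vc : compact (closure V)).
Implicit Types (E F U K : set Gam) (f : Gam -> C).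

Let Vnbhs : nbhs (0 : Gam) V. Proof. exact: open_nbhs_nbhs. Qed.

(** Covering by finitely many translates of [V] replaces relative compactness; it passes easily to
    sums and opposites. *)
Definition small E := exists s : seq Gam, forall h, E h -> exists2 a, a \in s & V (h - a).

Lemma compact_cover_shift K U : compact K -> nbhs (0 : Gam) U ->
  exists s : seq Gam, forall h, K h -> exists2 a, a \in s & U (h - a).
Proof.
move=> /compact_near_coveringP cK U0.
(* In the near-covering form of compactness the parameter is a finite list, tending to larger
   lists. *)
pose F := filter_from setT (fun s : seq Gam => [set t : seq Gam | {subset s <= t}]).
have FF : Filter F.
  apply: filter_from_filter; first by exists [::].
  move=> s t _ _; exists (s ++ t) => // u su; split => a au; apply: su;
    by rewrite mem_cat au ?orbT.
have [|s _ hs] := cK _ F (fun (s : seq Gam) (h : Gam) => exists2 a, a \in s & U (h - a)) FF.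
  move=> x Kx; exists ([set h : Gam | U (h - (x : Gam))],
      [set t : seq Gam | {subset [:: x : Gam] <= t}]).
    split; last by exists [:: x : Gam].
    by apply/nbhs_shift; apply: filterS U0 => h' /=; rewrite addrK.
  by move=> [h t] [/= Uh st]; exists x => //; apply: st; rewrite mem_head.
by exists s => h Kh; exact: (hs s).
Qed.

Lemma small_sub E F : E `<=` F -> small F -> small E.
Proof. by move=> EF [s hs]; exists s => h /EF/hs. Qed.

Lemma small_compact K : compact K -> small K.
Proof. by move=> cK; exact: compact_cover_shift. Qed.

Lemma small_fine E U : small E -> nbhs (0 : Gam) U ->
  exists s : seq Gam, forall h, E h -> exists2 a, a \in s & U (h - a).
Proof.
move=> [s hs] U0; have [t ht] := compact_cover_shift Vc U0.
exists [seq a + b | a <- s, b <- t] => h /hs[a sa /subset_closure/ht[b tb Ub]].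
by exists (a + b); [exact: allpairs_f|rewrite opprD addrA].
Qed.

Definition sumset E F : set Gam := [set h | exists g, E g /\ F (h - g)].

Lemma small_sumset E F : small E -> small F -> small (sumset E F).
Proof.
move=> sE sF; have [W W0 [_ _ WV]] := nbhs0_split Vnbhs.
have [s hs] := small_fine sE W0; have [t ht] := small_fine sF W0.
exists [seq a + b | a <- s, b <- t] => h [g [/hs[a sa Wa] /ht[b tb Wb]]].
exists (a + b); first exact: allpairs_f.
have -> : h - (a + b) = (g - a) + (h - g - b) by rewrite addrACA subrKC opprD.
exact: WV.
Qed.

Lemma small_opp E : small E -> small [set h | E (- h)].
Proof.
move=> sE; have [W W0 [WV WN _]] := nbhs0_split Vnbhs.
have [s hs] := small_fine sE W0.
exists [seq - a | a <- s] => h /hs[a sa /WN Wa]; exists (- a); first exact: map_f.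
by apply: WV; move: Wa; rewrite opprB !opprK addrC.
Qed.

Lemma small_seq (s : seq Gam) : small [set` s].
Proof. by exists s => h hs; exists h => //; rewrite subrr. Qed.

Lemma dominated_small E : small E -> dominated V (\1_E : Gam -> R).
Proof.
move=> [s hs]; exists [seq (1, a) | a <- s]; first by move=> _ /mapP[a _ ->].
move=> x; rewrite /convol big_map /= indicE; have [xE|xE] := boolP (x \in E); last first.
  by rewrite normr0 sumr_ge0// => a _; rewrite mul1r indic_ge0.
rewrite normr1; have [a sa Va] := hs x (set_mem xE).
rewrite (perm_big _ (perm_to_rem sa)) big_cons mul1r indicE mem_set//= lerDl.
by apply: sumr_ge0 => b _; rewrite mul1r indic_ge0.
Qed.

Lemma exists_bump : exists (b : Gam -> C) (B : R),
  [/\ continuous b, bounded_on setT b B, forall h, V h -> b h = 1 &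
      small [set h | b h <> 0]].
Proof.
have [I HI] := exists_invariant_functional V0 (R := R).
have [ID IZ I_ge0 Ish I1] := HI.
have [k [k01 kV kW kunif]] := exists_uniform_bump Vnbhs.
have sV : small V by apply: small_sub (small_compact Vc); exact: subset_closure.
pose VV := sumset V V; have sVV : small VV by exact: small_sumset.
pose m : Gam -> R := \1_VV.
have dm : dominated V m by exact: dominated_small.
have dk : dominated V k.
  apply: (dominated_le (dominated_indic V) ler01) => h; rewrite mul1r indicE.
  have /andP[k_ge0 k_le1] := k01 h; rewrite ger0_norm//.
  have [kh|/kV Vh] := eqVneq (k h) 0; first by rewrite kh.
  by rewrite mem_set// normr1.
have dmk g : dominated V (m \* translate g k).
  by apply: dominatedM => //; exact: dominated_shift.
(* [V] lies in finitely many translates of the set where k >= 1/2, so I k = 0 would force I 1_V =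
   0. *)
have Ik : 0 < I k.
  have Ik0 : 0 <= I k by apply: I_ge0 => // h; have /andP[] := k01 h.
  rewrite lt_neqAle Ik0 andbT; apply/eqP => Ik00.
  have [s hs] := small_fine sV kW.
  have [d2 I2] := functional_sum HI s (fun=> 2) (fun a => dominated_shift a dk).
  have : I \1_V <= I (fun x => \sum_(a <- s) 2 * translate a k x).
    apply: (functional_le HI) => //; first exact: dominated_indic.
    move=> x; rewrite indicE; have ksh a : 0 <= 2 * translate a k x.
      by rewrite mulr_ge0//; have /andP[] := k01 (x - a).
    have [xV|_] := boolP (x \in V); last by rewrite sumr_ge0.
    have [a sa ka] := hs x (set_mem xV).
    rewrite (perm_big _ (perm_to_rem sa)) big_cons -[leLHS]addr0 lerD ?sumr_ge0//.
    by move: ka; rewrite /= /translate; lra.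
  rewrite I2 I1 big1 ?ler10// => a _.
  by rewrite Ish// -Ik00 mulr0.
pose b0 g := I (m \* translate g k).
exists (fun g => rc (I k)^-1 * rc (b0 g)).
exists (cabs (rc (I k)^-1) * Num.sqrt (I (k \* k) * I (m \* m))); split.
- suff cb (g : Gam) (e : R) : 0 < e -> \forall g' \near g,
      cabs (rc (I k)^-1 * rc (b0 g') - rc (I k)^-1 * rc (b0 g)) < e.
    by apply/continuousP_cabs => g e; exact: cb.
  move=> e0.
  have Im0 : 0 <= I m by apply: I_ge0 => // h; exact: indic_ge0.
  have e1 : 0 < e * I k / (I m + 1) by rewrite divr_gt0 ?mulr_gt0// ltr_wpDl.
  apply: filterS (kunif g _ e1) => g' hg'.
  rewrite -mulrBr cabsM cabs_rc ger0_norm ?invr_ge0 1?ltW// ltr_pdivrMl// mulrC.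
  rewrite -rmorphB cabs_rc.
  have -> : b0 g' - b0 g = I (m \* translate g' k \+ (fun x => -1 * (m \* translate g k) x)).
    by rewrite ID// ?IZ ?mulN1r//; exact: dominatedZ.
  apply: le_lt_trans (_ : I (fun x => (e * I k / (I m + 1)) * m x) < _).
    apply: (functional_norm_le HI); [|exact: dominatedZ|].
      by apply: dominatedD => //; exact: dominatedZ.
    move=> h; rewrite /= mulN1r -mulrBr normrM ger0_norm ?indic_ge0// mulrC.
    by rewrite ler_wpM2r ?indic_ge0//; exact: hg'.
  rewrite IZ// mulrAC ltr_pdivrMr ?ltr_wpDl//.
  by rewrite ltr_pM2l ?mulr_gt0// ltrDl.
- have /(bounded_onZ (rc (I k)^-1)) bm := bounded_on_correlation HI dm dk.
  exact: bm.
(* For h in [V] the support of k (. - h) lies in V + V, so the factor [m] is invisible. *)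
- move=> h Vh; have -> : b0 h = I k.
    rewrite -(Ish k h dk); congr I; apply/funext => x /=.
    have [->|/kV Vx] := eqVneq (translate h k x) 0; first by rewrite mulr0.
    by rewrite /m indicE mem_set ?mul1r//; exists h.
  by rewrite -rcM mulVf// gt_eqF.
(* The support of the bump lies in V + V - V. *)
have sVN : small [set h | V (- h)] by exact: small_opp.
apply: small_sub (small_sumset sVV sVN) => g /= bg.
apply: contrapT => ng; apply: bg.
suff -> : b0 g = 0 by rewrite rc0 mulr0.
rewrite /b0 (_ : m \* translate g k = fun x => 0 * m x) ?IZ ?mul0r//.
apply/funext => x /=; rewrite mul0r; apply/eqP; rewrite mulf_eq0.
have [//|/kV Vx] := eqVneq (translate g k x) 0; first by rewrite orbT.
rewrite orbF /m indicE; have [xVV|//] := boolP (x \in VV).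
exfalso; apply: ng; exists x; split; first exact: set_mem.
by rewrite /= opprB.
Qed.

(** Greedy choice: a point is kept only if it is not [U]-close to a point already kept. *)
Lemma exists_separated (U : set Gam) (s : seq Gam) : U 0 -> (forall g, U g -> U (- g)) ->
  exists t : seq Gam, [/\ uniq t, forall a b, a \in t -> b \in t -> U (a - b) -> a = b &
    forall x, x \in s -> exists2 y, y \in t & U (x - y)].
Proof.
move=> U0 UN; elim: s => [|x s [t [ut tsep ts]]]; first by exists [::].
have [[y yt Uxy]|nx] := pselect (exists2 y, y \in t & U (x - y)).
  exists t; split => // z; rewrite in_cons => /predU1P[->|/ts//].
  by exists y.
exists (x :: t); split.
- rewrite /= ut andbT; apply/negP => xt; apply: nx; exists x => //.
  by rewrite subrr.
- move=> a b; rewrite !in_cons => /predU1P[->|at_] /predU1P[->|bt] // Uab.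
  + by exfalso; apply: nx; exists b.
  + by exfalso; apply: nx; exists a => //; rewrite -opprB; exact: UN.
  + exact: tsep.
- move=> z; rewrite in_cons => /predU1P[->|/ts[y yt Uzy]].
    by exists x; rewrite ?mem_head// subrr.
  by exists y => //; rewrite in_cons yt orbT.
Qed.

Lemma bounded_on_prod E (t : seq Gam) (f : Gam -> Gam -> C) (M : R) :
  (forall i, bounded_on E (f i) M) ->
  bounded_on E (fun h => \prod_(i <- t) f i h) (M ^+ size t).
Proof.
move=> fM; elim: t => [|i t IH].
  by rewrite expr0; apply: bounded_on_eq _ (bounded_on1 E) => h _; rewrite big_nil.
rewrite exprS; apply: bounded_on_eq _ (bounded_onM (fM i) IH) => h _.
by rewrite big_cons.
Qed.

Lemma continuous_shift (b : Gam -> C) (a : Gam) : continuous b ->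
  continuous (fun h : Gam => b (h - a)).
Proof.
move=> cb h; apply: (@continuous_comp _ _ _ (fun h : Gam => h - a) b); last exact: cb.
exact: dual_shift_continuous.
Qed.

Lemma continuous_subr1 f : continuous f -> continuous (fun h : Gam => 1 - f h).
Proof.
move=> /continuousP_cabs cf; apply/continuousP_cabs => h e e0.
apply: filterS (cf h e e0) => h'; rewrite cabs_distC.
by congr (cabs _ < _); ring.
Qed.

Lemma continuous_mulr f k : continuous f -> continuous k -> continuous (f \* k).
Proof.
by move=> cf ck h; apply: cvgM; [exact: nbhs_filter|exact: cf|exact: ck].
Qed.

(* [e = 1 - \prod_(i in t) (1 - b (- - i))] with [t] separated: only boundedly many
   factors differ from 1 on a given window, so the window norms are uniformly bounded. *)
Lemma exists_units : exists M : R, forall K, small K -> exists e : Gam -> C,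
  [/\ continuous e, forall h, K h -> e h = 1, small [set h | e h <> 0] &
      forall g, bounded_on (chtranslate (closure V) g) e M].
Proof.
have [b [B [cb bB bV sW]]] := exists_bump.
pose W := [set h | b h <> 0].
have B0 := bounded_on_ge0 bB.
have [U U0 [_ UN UV]] := nbhs0_split Vnbhs.
have [T T0 [_ TN TU]] := nbhs0_split U0.
have Unbhs0 : U 0 := nbhs_singleton U0.
(* The factor at i can differ from 1 on the window at g only if i - g lies in closure V - W. *)
pose Z := sumset (closure V) [set h | W (- h)].
have sZ : small Z by apply: small_sumset; [exact: small_compact|exact: small_opp].
have [zs hzs] := small_fine sZ T0.
exists (1 + (1 + B) ^+ size zs) => K sK.
have [s hs] := small_fine sK U0.
have [t [ut tsep ts]] := exists_separated s Unbhs0 UN.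
exists (fun h => 1 - \prod_(i <- t) (1 - b (h - i))); split.
- apply/continuous_subr1; elim: t {ut tsep ts} => [|i t IH].
    apply/continuousP_cabs => h e e0; apply: filterE => h'.
    by rewrite !big_nil subrr cabs0.
  rewrite (_ : (fun _ => _) = fun h => (1 - b (h - i)) * \prod_(j <- t) (1 - b (h - j))).
    have ci := continuous_subr1 (continuous_shift (a := i) cb).
    exact: (continuous_mulr ci IH).
  by apply/funext => h; rewrite big_cons.
- move=> h /hs[a /ts[y yt Uay] Uha].
  rewrite (perm_big _ (perm_to_rem yt)) big_cons bV /=; first by rewrite subrr mul0r subr0.
  by have := UV _ _ Uha Uay; rewrite addrA subrK.
- apply: small_sub (small_sumset (small_seq t) sW) => h /= eh.
  apply: contrapT => nh; apply: eh; rewrite big_seq big1 ?subrr// => i it.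
  rewrite (_ : b _ = 0) ?subr0//; apply: contrapT => bi; apply: nh.
  by exists i.
move=> g; pose t' := [seq i <- t | `[< Z (i - g) >]].
(* Two centres in the same translate of [T] differ by an element of [U], so separation identifies
   them. The count depends on neither [K] nor g. *)
have st' : (size t' <= size zs)%N.
  have zP i : i \in t' -> exists2 z, z \in zs & T (i - g - z).
    by rewrite mem_filter => /andP[/asboolP/hzs].
  have /choice[f hf] : forall i, exists z, i \in t' -> z \in zs /\ T (i - g - z).
    move=> i; have [/zP[z zz Tz]|it] := boolP (i \in t'); first by exists z.
    by exists 0.
  rewrite -(size_map f); apply: uniq_leq_size; last first.
    by move=> _ /mapP[i it ->]; have [] := hf i it.
  rewrite map_inj_in_uniq ?filter_uniq// => i j it jt fij.
  have [_ Ti] := hf i it; have [_ /TN Tj] := hf j jt.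
  have := TU _ _ Ti Tj; rewrite -fij opprB addrA subrK.
  rewrite opprB addrA subrK => Uij.
  move: it jt; rewrite !mem_filter => /andP[_ it] /andP[_ jt].
  exact: tsep.
have bE : bounded_on (chtranslate (closure V) g)
    (fun h => 1 - \prod_(i <- t') (1 - b (h - i))) (1 + (1 + B) ^+ size zs).
  have bi i : bounded_on (chtranslate (closure V) g) (fun h => 1 - b (h - i)) (1 + B).
    apply: (bounded_onB (bounded_on1 _)); apply: bounded_on_shift.
    exact: bounded_on_sub bB.
  have := bounded_onB (bounded_on1 _) (bounded_on_prod t' bi).
  apply: bounded_on_le; rewrite lerD2l ler_weXn2l// lerDl//.
apply: bounded_on_eq _ bE => h /chtranslateE Vh; congr (1 - _).
rewrite big_filter big_mkcond [LHS]big_seq [RHS]big_seq; apply: eq_bigr => i it.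
case: asboolP => // nZ; rewrite (_ : b _ = 0) ?subr0//; apply: contrapT => bi.
apply: nZ; exists (h - g); split => //=.
by rewrite /W /= !opprB addrA subrK.
Qed.

Lemma exists_Kset K : small K -> exists2 Om, Kset Om & K `<=` Om.
Proof.
(* Adding the centre 0 makes the interior nonempty even when [s] is empty. *)
move=> [s hs]; pose O := [set h : Gam | exists2 a, a \in 0 :: s & V (h - a)].
have oO : open O.
  rewrite openE => h [a sa Va].
  have : nbhs h [set h' | V (h' - a)].
    by apply: dual_shift_continuous; apply: open_nbhs_nbhs.
  by apply: filterS => h' Vh'; exists a.
have [D [cD clD OD]] : exists D : set Gam, [/\ compact D, closed D & O `<=` D].
  rewrite /O; elim: (0 :: s) => [|a r [D [cD clD OD]]].
    by exists set0; split; [exact: compact0|exact: closed0|move=> h []].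
  pose Va := [set h : Gam | closure V (h - a)].
  exists (Va `|` D); split.
  - apply: compactU => //.
    have -> : Va = (fun h : Gam => h + a) @` closure V.
      apply/seteqP; split => h /=; first by exists (h - a); rewrite ?subrK.
      by case=> h' Vh' <-; rewrite /Va /= addrK.
    apply: continuous_compact => //; apply: continuous_subspaceT.
    exact: dual_shift_continuous.
  - apply: closedU => //; apply: (preimage_closed _ (@closed_closure _ V)).
    by move=> h _; exact: dual_shift_continuous.
  - move=> h [x]; rewrite in_cons => /predU1P[->|xr] Vx; last by right; apply: OD; exists x.
    by left; exact: subset_closure.
exists (closure O); last first.
  move=> h /hs[a sa Va]; apply: subset_closure; exists a => //.
  by rewrite in_cons sa orbT.
have OiO : O `<=` interior (closure O).
  by rewrite -open_subsetE//; exact: subset_closure.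
split.
- apply: (subclosed_compact _ cD); first exact: closed_closure.
  rewrite [X in _ `<=` X](closure_id D).1//; exact: closureS.
- by exists (0 : Gam); apply: OiO; exists (0 : Gam); rewrite ?mem_head// subrr.
- exact: closureS.
Qed.

(** Windows centred outside supp f - closure V miss the support, so the local norms vanish there. *)
Lemma A_alg_small f (M : R) : continuous f -> small [set h | f h <> 0] ->
  (forall g, bounded_on (chtranslate (closure V) g) f M) -> A_alg (closure V) f.
Proof.
move=> cf sf fM; split.
  split; last by apply: le_lt_trans (ltry M); exact/bse_norm_le.
  split=> //; exists M => g; apply: bounded_on_pt (fM g); apply/chtranslateE.
  by rewrite subrr; exact: subset_closure.
move=> e e0.
have sF : small (sumset [set h : Gam | f h <> 0] [set h : Gam | closure V (- h)]).
  by apply: small_sumset => //; apply: small_opp; exact: small_compact.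
have [Om KOm sOm] := exists_Kset sF; exists Om => // Om' _ OO.
apply: ge_ereal_sup => _ [g gO <-]; apply/bse_norm_at_le.
apply: (bounded_on_le (ltW e0)).
apply: (bounded_on_eq _ (bounded_on0 _)) => h /chtranslateE Vh; apply/esym.
apply: contrapT => fh; apply: gO; apply/OO/sOm; exists h; split => //=.
by rewrite opprB.
Qed.

End Units.

(** * Segal algebras *)

Section SegalAlgebras.
Context {R : realType} {G : topologicalZmodType}.
Local Notation C := (CC R).
Local Notation Gam := (dual R G).
Variable V : set Gam.
Hypotheses (Vo : open V) (V0 : V 0) (Vc : compact (closure V)).
Local Notation Vb := (closure V).
Implicit Types (f k phi psi : Gam -> C).

Lemma C_BSE_bound phi : C_BSE Vb phi ->
  forall g, bounded_on (chtranslate Vb g) phi (bse_normR Vb phi).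
Proof. by case=> _; exact: bse_normR_bound. Qed.

Lemma mem_window g : chtranslate Vb g g.
Proof. by apply/chtranslateE; rewrite subrr; exact: subset_closure. Qed.

Lemma A_algM phi psi : C_BSE Vb phi -> A_alg Vb psi -> A_alg Vb (phi \* psi).
Proof.
move=> Cphi [Cpsi psi0]; have phiN := C_BSE_bound Cphi.
have N0 := bounded_on_ge0 (phiN 0).
have [[cphi [M1 hM1]] _] := Cphi; have [[cpsi [M2 hM2]] _] := Cpsi.
split.
  split; last first.
    apply: le_lt_trans (ltry (bse_normR Vb phi * bse_normR Vb psi)); apply/bse_norm_le => g.
    by apply: bounded_onM => //; exact: C_BSE_bound.
  split; first exact: continuous_mulr.
  exists (M1 * M2) => g; rewrite cabsM; apply: ler_pM; rewrite ?cabs_ge0//.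
move=> e e0; set N := bse_normR Vb phi in phiN N0.
have e1 : 0 < e / (N + 1) by rewrite divr_gt0// ltr_wpDl.
have [Om0 KOm0 hOm0] := psi0 _ e1; exists Om0 => // Om KOm OO.
apply: ge_ereal_sup => _ [g gO <-]; apply/bse_norm_at_le.
have psig : bounded_on (chtranslate Vb g) psi (e / (N + 1)).
  apply/bse_norm_at_le; apply: le_trans (hOm0 Om KOm OO).
  by apply: ereal_sup_ubound; exists g.
apply: (bounded_on_le _ (bounded_onM (phiN g) psig)).
rewrite mulrCA ger_pMr// ler_pdivrMr ?mul1r ?ltr_wpDl//.
by rewrite lerDl.
Qed.

(** [u] equals 1 on Om + closure V, which removes psi - u psi from windows centred in Om; elsewhere
    its local norm is at most 1 + M times that of psi. [M] is fixed before psi and e. *)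
Lemma approximate_units : exists2 M : R, 0 <= M &
  forall psi, A_alg Vb psi -> forall e : R, 0 < e -> exists u : Gam -> C,
  [/\ A_alg Vb u, forall g, bounded_on (chtranslate Vb g) u M &
    forall g, bounded_on (chtranslate Vb g) (psi \- u \* psi) e].
Proof.
have [M hM] := exists_units Vo V0 Vc.
have M0 : 0 <= M.
  have [|u [_ _ _ /(_ 0)]] := hM set0; last exact: bounded_on_ge0.
  by exists [::] => h [].
exists M => // psi Apsi e e0.
have [Cpsi psi0] := Apsi.
have e1 : 0 < e / (1 + M) by rewrite divr_gt0// ltr_wpDr.
have [Om KOm hOm] := psi0 _ e1; have [cOm _ _] := KOm.
have sK : small V (sumset Om Vb).
  by apply: small_sumset => //; exact: small_compact.
have [u [cu u1 su ub]] := hM _ sK.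
exists u; split => // [|g]; first exact: A_alg_small cu su ub.
have [gO|gO] := pselect (Om g).
  apply: (bounded_on_le (ltW e0)).
  apply: (bounded_on_eq _ (bounded_on0 _)) => h /chtranslateE Vh /=.
  by rewrite u1 ?mul1r ?subrr//; exists g.
have psig : bounded_on (chtranslate Vb g) psi (e / (1 + M)).
  apply/bse_norm_at_le; apply: le_trans (hOm Om KOm (fun _ => id)).
  by apply: ereal_sup_ubound; exists g.
have := bounded_onM (bounded_onB (bounded_on1 _) (ub g)) psig.
rewrite mulrC divfK ?gt_eqF ?ltr_wpDr//.
by apply: bounded_on_eq => h _ /=; rewrite mulrBl mul1r.
Qed.

Variables (S : set (Gam -> C)) (nS : (Gam -> C) -> R).
Hypothesis HS : segal_algebra Vb S nS.

Let SA f : S f -> A_alg Vb f. Proof. by case: HS => -[SA _] _ _ _ _; exact: SA. Qed.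
Let S0 : S (fun=> 0). Proof. by case: HS => -[_ [S0 _]] _ _ _ _. Qed.
Let SD f k : S f -> S k -> S (f \+ k).
Proof. by case: HS => -[_ [_ [SD _]]] _ _ _ _; exact: SD. Qed.
Let SZ (a : C) f : S f -> S (fun g => a * f g).
Proof. by case: HS => -[_ [_ [_ SZ]]] _ _ _ _; exact: SZ. Qed.
Let SM f k : S f -> A_alg Vb k -> S (f \* k).
Proof. by case: HS => _ SM _ _ _; exact: SM. Qed.
Let Sdense psi : A_alg Vb psi -> forall e : R, 0 < e ->
  exists2 phi, S phi & (bse_norm Vb (psi \- phi)%R < e%:E)%E.
Proof. by case: HS => _ _ Sdense _ _; exact: Sdense. Qed.
Let nS_ge0 f : S f -> 0 <= nS f. Proof. by case: HS => _ _ _ [h _ _ _ _] _; exact: h. Qed.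
Let nSD f k : S f -> S k -> nS (f \+ k) <= nS f + nS k.
Proof. by case: HS => _ _ _ [_ _ h _ _] _; exact: h. Qed.
Let nSZ (a : C) f : S f -> nS (fun g => a * f g) = cabs a * nS f.
Proof. by case: HS => _ _ _ [_ _ _ h _] _; exact: h. Qed.
Let Scomplete (u : nat -> Gam -> C) : (forall n, S (u n)) ->
  (forall eps : R, 0 < eps -> exists N, forall m n, (N <= m)%N -> (N <= n)%N ->
     nS (u m \- u n) < eps) ->
  exists2 l, S l & forall eps : R, 0 < eps -> exists N, forall n, (N <= n)%N ->
     nS (u n \- l) < eps.
Proof. by case: HS => _ _ _ [_ _ _ _ h] _; exact: h. Qed.
Let le_nS f : S f -> (bse_norm Vb f <= (nS f)%:E)%E.
Proof. by case: HS => _ _ _ _ [h _ _]; exact: h. Qed.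
Let nSM f k : S f -> A_alg Vb k -> nS (f \* k) <= nS f * bse_normR Vb k.
Proof. by case: HS => _ _ _ _ [_ h _]; exact: h. Qed.
Let Sunits f : S f -> forall e : R, 0 < e -> exists2 u, S u & nS (f \- u \* f) < e.
Proof. by case: HS => _ _ _ _ [_ _ h]; exact: h. Qed.

Lemma segalN_eq f : (fun g => - f g) = (fun g => -1 * f g).
Proof. by apply/funext => g; rewrite mulN1r. Qed.

Lemma segalB f k : S f -> S k -> S (f \- k).
Proof.
move=> Sf Sk; have := SD Sf (SZ (-1) Sk); rewrite -segalN_eq; exact.
Qed.

Lemma segal_normN f : S f -> nS (fun g => - f g) = nS f.
Proof. by move=> Sf; rewrite segalN_eq nSZ// cabsN cabs1 mul1r. Qed.

Lemma segal_normB f k : S f -> S k -> nS (f \- k) <= nS f + nS k.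
Proof.
move=> Sf Sk; rewrite -(segal_normN Sk); apply: nSD => //.
by rewrite segalN_eq; exact: SZ.
Qed.

Lemma segal_dist_triangle f k l : S f -> S k -> S l ->
  nS (f \- l) <= nS (f \- k) + nS (k \- l).
Proof.
move=> Sf Sk Sl; have := nSD (segalB Sf Sk) (segalB Sk Sl).
by rewrite (_ : (f \- k) \+ (k \- l) = f \- l)//; apply/funext => g /=; ring.
Qed.

Lemma segal_distC f k : S f -> S k -> nS (f \- k) = nS (k \- f).
Proof.
move=> Sf Sk; rewrite -segal_normN; last exact: segalB.
by congr nS; apply/funext => g /=; ring.
Qed.

Lemma segal_pt f g : S f -> cabs (f g) <= nS f.
Proof.
by move=> Sf; have /bse_norm_le/(_ g) := le_nS Sf; apply: bounded_on_pt; exact: mem_window.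
Qed.

(** Units [w] of the Segal algebra carry no uniform bound. They serve only to pass from psi to w
    psi; a bounded [u] then approximates on [w] in the weaker norm. *)
Lemma segal_bounded_units : exists2 M : R, 0 <= M & forall psi, S psi -> forall e : R, 0 < e ->
  exists u : Gam -> C, [/\ A_alg Vb u, forall g, bounded_on (chtranslate Vb g) u M &
    nS (psi \- u \* psi) < e].
Proof.
have [M M0 hM] := approximate_units; exists M => // psi Spsi e e0.
have n0 := nS_ge0 Spsi.
pose d := e / (1 + M + nS psi + 1).
have D0 : 0 < 1 + M + nS psi + 1 by lra.
have d0 : 0 < d by rewrite divr_gt0.
have [w Sw hw] := Sunits Spsi d0.
have [u [Au ub uw]] := hM w (SA Sw) d d0.
exists u; split => //.
have Sr : S (psi \- w \* psi).
  apply: segalB => //; rewrite (_ : w \* psi = psi \* w); first by apply: SM => //; exact: SA.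
  by apply/funext => g /=; rewrite mulrC.
have Sw' : S (w \- w \* u) by apply: segalB => //; exact: SM.
(* With r = psi - w psi, the error is (r - r u) + psi (w - w u), of norm at most d (1 + M + nS
   psi). *)
have -> : psi \- u \* psi = ((psi \- w \* psi) \- (psi \- w \* psi) \* u) \+ psi \* (w \- w \* u).
  by apply/funext => g /=; ring.
apply: le_lt_trans (nSD _ _) _; [|exact: SM (SA _)|].
  by apply: segalB => //; exact: SM.
have h1 := segal_normB Sr (SM Sr Au).
have h2 : nS ((psi \- w \* psi) \* u) <= nS (psi \- w \* psi) * M.
  apply: le_trans (nSM Sr Au) _; rewrite ler_wpM2l ?nS_ge0//.
  exact: bse_normR_le.
have h3 : nS (psi \* (w \- w \* u)) <= nS psi * d.
  apply: le_trans (nSM Spsi (SA Sw')) _; rewrite ler_wpM2l//.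
  apply: bse_normR_le => g; apply: bounded_on_eq (uw g) => h _ /=; ring.
have h4 : d * (1 + M + nS psi + 1) = e by rewrite divfK// gt_eqF.
have r0 := nS_ge0 Sr; nra.
Qed.

(** An a priori estimate: phi itself need not lie in [A_alg], but phi u does, and its norm is at
    most M times that of phi. *)
Lemma segal_multiplier_bound : exists2 M : R, 0 <= M & forall phi chi, C_BSE Vb phi -> S chi ->
  S (phi \* chi) -> nS (phi \* chi) <= bse_normR Vb phi * M * nS chi.
Proof.
have [M M0 hM] := segal_bounded_units; exists M => // phi chi Cphi Schi Spc.
apply/ler_addgt0Pr => e e0; have [u [Au ub /ltW hu]] := hM _ Spc e e0.
have Apu := A_algM Cphi Au.
have Spu := SM Schi Apu.
have -> : phi \* chi = chi \* (phi \* u) \+ (phi \* chi \- u \* (phi \* chi)).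
  by apply/funext => g /=; ring.
have Sd : S (phi \* chi \- u \* (phi \* chi)).
  apply: segalB => //; rewrite (_ : u \* _ = chi \* (phi \* u))//.
  by apply/funext => g /=; ring.
apply: le_trans (nSD Spu Sd) _; apply: lerD => //.
apply: le_trans (nSM Schi Apu) _; rewrite mulrC ler_wpM2r ?nS_ge0//.
by apply: bse_normR_le => g; apply: bounded_onM => //; exact: C_BSE_bound.
Qed.

Lemma C_BSE_multiplier phi psi : C_BSE Vb phi -> S psi -> S (phi \* psi).
Proof.
move=> Cphi Spsi; have [M M0 hM] := segal_bounded_units.
have [M' M'0 hM'] := segal_multiplier_bound.
have [[_ [B hB]] _] := Cphi.
have /choice[u hu] : forall n : nat, exists u : Gam -> C, A_alg Vb u /\
    nS (psi \- u \* psi) < n.+1%:R^-1.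
  move=> n; have n0 : 0 < n.+1%:R^-1 :> R by rewrite invr_gt0.
  by have [u [Au _ h]] := hM _ Spsi _ n0; exists u.
have Su n : S (u n \* psi).
  rewrite (_ : _ \* _ = psi \* u n); first by apply: SM => //; exact: (hu n).1.
  by apply/funext => g /=; rewrite mulrC.
pose w n := phi \* (u n \* psi).
have Sw n : S (w n).
  rewrite (_ : w n = psi \* (phi \* u n)); first by apply/SM/A_algM/(hu n).1.
  by apply/funext => g; rewrite /w /=; ring.
pose N := bse_normR Vb phi * M'.
have phiN := C_BSE_bound Cphi.
have N0 : 0 <= N by rewrite mulr_ge0// (bounded_on_ge0 (phiN 0)).
(* The difference is phi times a difference of two remainders psi - u psi, so the a priori estimate
   applies. *)
have wdist m n : nS (w m \- w n) <= N * (m.+1%:R^-1 + n.+1%:R^-1).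
  have -> : w m \- w n = phi \* ((psi \- u n \* psi) \- (psi \- u m \* psi)).
    by apply/funext => g; rewrite /w /=; ring.
  have Sr i : S (psi \- u i \* psi) by exact: segalB.
  apply: le_trans (hM' _ _ Cphi (segalB (Sr n) (Sr m)) _) _.
    rewrite (_ : phi \* _ = w m \- w n); first exact: segalB.
    by apply/funext => g; rewrite /w /=; ring.
  rewrite ler_wpM2l//; apply: le_trans (segal_normB (Sr n) (Sr m)) _.
  by rewrite addrC lerD//; exact/ltW/(hu _).2.
have inv_small (e : R) : 0 < e -> exists K, forall n, (K <= n)%N -> n.+1%:R^-1 < e.
  move=> e0; have [K hK] : exists K : nat, e^-1 < K%:R by eexists; exact: truncnS_gt.
  exists K => n Kn; rewrite invf_plt ?posrE//; apply: lt_le_trans hK _.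
  by rewrite ler_nat leqW.
have [|l Sl lw] := Scomplete Sw.
  move=> e e0; have e1 : 0 < e / (2 * (N + 1)) by rewrite divr_gt0// mulr_gt0// ltr_wpDl.
  have [K hK] := inv_small _ e1; exists K => m n Km Kn.
  apply: le_lt_trans (wdist m n) _; have := hK _ Km; have := hK _ Kn.
  set x := m.+1%:R^-1; set y := n.+1%:R^-1; set d := e / _ => yd xd.
  have de : d * (2 * (N + 1)) = e by rewrite divfK// gt_eqF// mulr_gt0// ltr_wpDl.
  have x0 : 0 < x by rewrite invr_gt0.
  nra.
suff -> : phi \* psi = l by [].
(* The limit is identified pointwise: the Segal norm dominates point values, and phi is bounded. *)
apply/funext => g; apply/eqP; rewrite -subr_eq0; apply/eqP/cabs0_eq0/eqP.
rewrite eq_le cabs_ge0 andbT; apply/ler_addgt0Pr => e e0; rewrite add0r.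
have B0 : 0 <= B := le_trans (cabs_ge0 _) (hB g).
have e3 : 0 < e / 2 by rewrite divr_gt0.
have [K1 hK1] := lw _ e3.
have e4 : 0 < e / (2 * (B + 1)) by rewrite divr_gt0// mulr_gt0// ltr_wpDl.
have [K2 hK2] := inv_small _ e4.
pose n := maxn K1 K2.
have h1 := le_lt_trans (segal_pt g (segalB (Sw n) Sl)) (hK1 n (leq_maxl _ _)).
have h2 := lt_trans (le_lt_trans (segal_pt g (segalB Spsi (Su n))) (hu n).2) (hK2 n (leq_maxr _ _)).
have -> : (phi \* psi) g - l g = phi g * (psi \- u n \* psi) g + (w n \- l) g.
  by rewrite /w /=; ring.
apply: le_trans (cabsD _ _) _; rewrite cabsM.
have h3 : cabs (phi g) * cabs ((psi \- u n \* psi) g) <= B * (e / (2 * (B + 1))).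
  by apply: ler_pM; rewrite ?cabs_ge0// ltW.
have h4 : B * (e / (2 * (B + 1))) <= e / 2.
  have de : e / (2 * (B + 1)) * (2 * (B + 1)) = e.
    by rewrite divfK// gt_eqF// mulr_gt0// ltr_wpDl.
  move: e4 de; set d := e / (_ * _) => d0 de; lra.
lra.
Qed.

(* Gliding hump: pick functionals [L j] with large values on small perturbations of
   the previous point, the perturbations being negligible for the earlier ones. *)
Lemma segal_uniform_bounded (J : Type) (L : J -> (Gam -> C) -> C) :
  (forall j f k, S f -> S k -> L j (f \+ k) = L j f + L j k) ->
  (forall j a f, S f -> L j (fun g => a * f g) = a * L j f) ->
  (forall j, exists2 K : R, 0 <= K & forall f, S f -> cabs (L j f) <= K * nS f) ->
  (forall f, S f -> exists B : R, forall j, cabs (L j f) <= B) ->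
  exists2 D : R, 0 <= D & forall j f, S f -> cabs (L j f) <= D * nS f.
Proof.
move=> LD LZ Lb Lpt; apply: contrapT => nD.
have LB j f k : S f -> S k -> L j (f \- k) = L j f - L j k.
  move=> Sf Sk; rewrite (_ : f \- k = f \+ (fun g => -1 * k g)).
    by rewrite LD ?LZ ?mulN1r//; exact: SZ.
  by apply/funext => g /=; rewrite mulN1r.
have big (D : R) : 0 <= D -> exists j f, [/\ S f, nS f <= 1 & D < cabs (L j f)].
  move=> D0; apply: contrapT => nb; apply: nD; exists D => // j f Sf.
  have n0 := nS_ge0 Sf; have [f0|f0] := eqVneq (nS f) 0.
    by have [K _ hK] := Lb j; rewrite f0 mulr0; have := hK f Sf; rewrite f0 mulr0.
  have {f0}n0 : 0 < nS f by rewrite lt_neqAle eq_sym f0.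
  rewrite leNgt; apply/negP => hf; apply: nb.
  have cn : cabs (rc (nS f)^-1) = (nS f)^-1 by rewrite cabs_rc ger0_norm// invr_ge0 ltW.
  exists j, (fun g => rc (nS f)^-1 * f g); split; first exact: SZ.
    by rewrite nSZ// cn mulVf// gt_eqF.
  by rewrite LZ// cabsM cn mulrC ltr_pdivlMr.
pose step (n : nat) (p q : (Gam -> C) * R) := S p.1 -> 0 < p.2 <= 1 ->
  [/\ S q.1, 0 < q.2 <= 1, nS (q.1 \- p.1) <= p.2, 2 * q.2 <= p.2 & exists j,
    n%:R + 1 <= cabs (L j q.1) /\ forall f, S f -> nS f <= 2 * q.2 -> cabs (L j f) <= 1].
have /choice[F hF] : forall np : nat * ((Gam -> C) * R), exists q, step np.1 np.2 q.
  move=> [n [x r]] /=; rewrite /step /=.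
  have [[Sx /andP[r0 r1]]|no] := pselect (S x /\ 0 < r <= 1); last first.
    by exists (x, r) => Sx rr; exfalso; apply: no.
  have D0 : 0 <= (n%:R + 1) / r by rewrite divr_ge0 ?addr_ge0// ltW.
  have [j [y [Sy y1 /ltW yL]]] := big _ D0.
  have [K K0 hK] := Lb j.
  have cr : cabs (rc r) = r by rewrite cabs_rc ger0_norm// ltW.
  pose z g := rc r * y g; have Sz : S z by exact: SZ.
  have nz : nS z <= r by rewrite nSZ// cr ger_pMr.
  have Lz : n%:R + 1 <= cabs (L j z).
    by move: yL; rewrite LZ// cabsM cr ler_pdivrMr// mulrC.
  have [x' [Sx' nx' Lx']] : exists x', [/\ S x', nS (x' \- x) <= r & n%:R + 1 <= cabs (L j x')].
    (* L (x + z) - L (x - z) = 2 L z, so one of the two points has a large value. *)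
    have [h|h] := leP (n%:R + 1) (cabs (L j (x \+ z))).
      exists (x \+ z); split => //; first exact: SD.
      by rewrite (_ : _ \- _ = z)//; apply/funext => g /=; ring.
    exists (x \- z); split; first exact: segalB.
      rewrite (_ : _ \- _ = fun g => - z g) ?segal_normN//.
      by apply/funext => g /=; ring.
    have := cabsB (L j (x \+ z)) (L j (x \- z)).
    rewrite {1}LD// {1}LB// (_ : _ - _ = L j z + L j z); last by ring.
    have -> : L j z + L j z = rc 2 * L j z by rewrite /rc rmorph_nat mulr_natl mulr2n.
    by rewrite cabsM cabs_rc ger0_norm//; lra.
  have KK : 0 < 2 * (K + 1) by lra.
  have rK : 0 < r / (2 * (K + 1)) by rewrite divr_gt0.
  have rKe : r / (2 * (K + 1)) * (2 * (K + 1)) = r by rewrite divfK// gt_eqF.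
  (* This radius r' satisfies 2 r' <= r and 2 K r' <= 1, so later changes move the value of L j by
     at most 1. *)
  exists (x', r / (2 * (K + 1))) => _ _ /=; move: rK rKe; set r' := r / _ => rK rKe.
  have r'r : 2 * r' <= r by nra.
  split => //; first by rewrite rK /=; lra.
  exists j; split => // f Sf nf; apply: le_trans (hK f Sf) _.
  have := nS_ge0 Sf; nra.
pose st := fix st n := if n is m.+1 then F (m, st m) else ((fun=> 0) : Gam -> C, 1 : R).
pose x n := (st n).1; pose r n := (st n).2.
have inv n : S (x n) /\ 0 < r n <= 1.
  elim: n => [|n [Sx rx]]; first by rewrite /x /r /= ltr01 lexx.
  by have [] := hF (n, st n) Sx rx.
have Sx n := (inv n).1; have r0 n : 0 < r n by have /andP[] := (inv n).2.
have hst n : [/\ nS (x n.+1 \- x n) <= r n, 2 * r n.+1 <= r n & exists j,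
    n%:R + 1 <= cabs (L j (x n.+1)) /\
    forall f, S f -> nS f <= 2 * r n.+1 -> cabs (L j f) <= 1].
  by have [_ _] := hF (n, st n) (inv n).1 (inv n).2.
have tail n i : nS (x (n + i)%N \- x n) + 2 * r (n + i)%N <= 2 * r n.
  elim: i => [|i IH].
    rewrite addn0 (_ : x n \- x n = fun=> 0 * 0); last by apply/funext => g /=; ring.
    by rewrite nSZ// cabs0 mul0r add0r.
  rewrite addnS; have [h1 h2 _] := hst (n + i)%N.
  have := segal_dist_triangle (Sx (n + i).+1) (Sx (n + i)%N) (Sx n); lra.
have tail' n m : (n <= m)%N -> nS (x m \- x n) <= 2 * r n.
  move=> nm; have := tail n (m - n)%N; rewrite subnKC//.
  have := r0 m; lra.
have rsmall n : r n * n.+1%:R <= 1.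
  elim: n => [|n IH]; first by rewrite mulr1.
  have [_ h _] := hst n; move: IH h; have := r0 n; have := r0 n.+1.
  rewrite -[n.+2%:R]natr1 -[n.+1%:R]natr1.
  have : 0 <= n%:R :> R by []. 
  move: (n%:R) (r n) (r n.+1) => y a b; nra.
have rlim (e : R) : 0 < e -> exists n, r n < e.
  move=> e0; have [n hn] : exists n : nat, e^-1 < n%:R by eexists; exact: truncnS_gt.
  exists n; rewrite ltNge; apply/negP => er.
  have := rsmall n; rewrite -natr1.
  have : 1 < e * n%:R by rewrite mulrC -ltr_pdivrMr// mul1r.
  have : 0 <= n%:R :> R by [].
  nra.
have [|l Sl lx] := Scomplete Sx.
  move=> e e0; have e4 : 0 < e / 4 by rewrite divr_gt0.
  have [N hN] := rlim _ e4; exists N => m n Nm Nn.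
  apply: le_lt_trans (segal_dist_triangle (Sx m) (Sx N) (Sx n)) _.
  rewrite (segal_distC (Sx N) (Sx n)).
  have := tail' _ _ Nm; have := tail' _ _ Nn; lra.
have ltail n : nS (l \- x n) <= 2 * r n.
  apply/ler_addgt0Pr => e e0; have [N hN] := lx _ e0.
  apply: le_trans (segal_dist_triangle Sl (Sx (maxn N n)) (Sx n)) _.
  rewrite addrC lerD//; first exact/tail'/leq_maxr.
  by rewrite segal_distC//; exact/ltW/hN/leq_maxl.
have [B hB] := Lpt l Sl.
have [n hn] : exists n : nat, B < n%:R by eexists; exact: truncnS_gt.
have [_ _ [j [Lj1 Lj2]]] := hst n.
have h1 := Lj2 _ (segalB Sl (Sx n.+1)) (ltail n.+1).
have : cabs (L j (x n.+1)) <= cabs (L j l) + cabs (L j (l \- x n.+1)).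
  have -> : L j (x n.+1) = L j l - L j (l \- x n.+1) by rewrite LB//; ring.
  exact: cabsB.
have := hB j; lra.
Qed.

Lemma multiplier_C_BSE phi : iso_translation_invariant S nS ->
  multipliers S phi -> C_BSE Vb phi.
Proof.
move=> HT [Cphi phiS]; split => //.
(* The index runs over unit-ball polynomials of all windows; pointwise boundedness holds because phi
   f lies in [S], hence has finite norm. *)
pose J := {sc : seq Gam * (Gam -> C) | exists g, span_unit_ball (chtranslate Vb g) sc.1 sc.2}.
pose L (j : J) f := \sum_(h <- (sval j).1) (sval j).2 h * (phi h * f h).
have [||||D D0 hD] := @segal_uniform_bounded J L.
- move=> j f k _ _; rewrite /L -big_split /=; apply: eq_bigr => h _; ring.
- move=> j a f _; rewrite /L big_distrr /=; apply: eq_bigr => h _; ring.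
- move=> j; exists (\sum_(h <- (sval j).1) cabs ((sval j).2 h * phi h)).
    by apply: sumr_ge0 => h _; exact: cabs_ge0.
  move=> f Sf; rewrite big_distrl /=; apply: le_trans (cabs_sum _ _) _.
  apply: ler_sum => h _; rewrite mulrA [leLHS]cabsM ler_wpM2l ?cabs_ge0//.
  exact: segal_pt.
- move=> f Sf; have [Cpf _] := SA (phiS f Sf).
  exists (bse_normR Vb (phi \* f)) => -[[s c] [g sc]].
  exact: (C_BSE_bound Cpf sc).
have [M hM] := exists_units Vo V0 Vc.
have [e [ce e1 se eb]] := hM _ (small_compact Vo V0 Vc).
have h2 : 0 < 2^-1 :> R by rewrite invr_gt0.
have [f Sf hf] := Sdense (A_alg_small Vo V0 Vc ce se eb) h2.
have {hf}/bse_norm_le hf := ltW hf.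
pose A := D * nS f.
have A0 : 0 <= A by rewrite mulr_ge0 ?nS_ge0.
suff key g : bounded_on (chtranslate Vb g) phi (2 * A).
  by apply: le_lt_trans (ltry (2 * A)); exact/bse_norm_le.
move=> s c sc; have [us sE P1] := sc.
(* Restricting to the finitely many frequencies of [s] gives phi a finite, though not uniform,
   initial bound. *)
pose E : set Gam := [set` s].
have EV : E `<=` chtranslate Vb g by move=> h hs; exact: sE.
have [_ [B hB]] := Cphi.
have B0 : 0 <= B := le_trans (cabs_ge0 _) (hB 0).
have start : bounded_on E phi ((size s)%:R * B).
  move=> s' c' [us' sE' P1']; apply: le_trans (cabs_sum _ _) _.
  apply: (@le_trans _ _ (\sum_(h <- s') B)).
    rewrite big_seq [leRHS]big_seq; apply: ler_sum => h hs'.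
    rewrite cabsM -[leRHS]mul1r; apply: ler_pM; rewrite ?cabs_ge0//.
    by apply: coefficient_bound us' hs' _ => x; rewrite -norm_le1.
  rewrite big_const_seq count_predT iter_addr_0 -[leLHS]mulr_natl ler_wpM2r// ler_nat.
  by apply: uniq_leq_size => // h /sE'.
(* On the window at g, e (. - g) = 1, so phi = phi f(. - g) + phi (e - f)(. - g). The first term is
   bounded by [A] since translation keeps the Segal norm, the second by M' / 2. Iterating M' -> A +
   M' / 2 tends to 2 A, independent of [s]. *)
have half M' : bounded_on E phi M' -> bounded_on E phi (A + M' / 2).
  move=> hM'; have [Sfg nfg] := HT f Sf g.
  have b1 : bounded_on E (phi \* (fun h => f (h - g))) A.
    move=> s' c' [us' sE' P1'].
    have sc' : span_unit_ball (chtranslate Vb g) s' c'.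
      by split => // h /sE'; exact: EV.
    have := hD (exist _ (s', c') (ex_intro _ g sc')) _ Sfg; rewrite nfg; exact.
  have b2 : bounded_on E (fun h => (e \- f) (h - g)) 2^-1.
    apply: bounded_on_shift; apply: bounded_on_sub (hf 0) => h /EV /chtranslateE.
    by rewrite addrK => Vh; apply/chtranslateE; rewrite subr0.
  apply: bounded_on_eq (bounded_onD b1 (bounded_onM hM' b2)) => h Eh /=.
  have /chtranslateE Vh := EV _ Eh; rewrite e1//; ring.
have approx n : bounded_on E phi (2 * A + (size s)%:R * B / (2 ^ n)%:R).
  elim: n => [|n IH].
    by rewrite expn0 divr1; apply: bounded_on_le start; rewrite lerDr mulr_ge0.
  apply: bounded_on_le (half _ IH).
  have -> : (size s)%:R * B / (2 ^ n.+1)%:R = (size s)%:R * B / (2 ^ n)%:R / 2.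
    by rewrite expnSr natrM invfM mulrA.
  by set q := _ / (2 ^ n)%:R; lra.
have scE : span_unit_ball E s c by [].
apply/ler_addgt0Pr => d d0.
have [n hn] : exists n : nat, (size s)%:R * B / d < n%:R by eexists; exact: truncnS_gt.
apply: le_trans (approx n s c scE) _; rewrite lerD2l ler_pdivrMr ?ltr0n ?expn_gt0//.
rewrite [leRHS]mulrC -ler_pdivrMr//; apply: le_trans (ltW hn) _.
by rewrite ler_nat ltnW// ltn_expl.
Qed.

End SegalAlgebras.

Theorem theorem6p1 (R : realType) (G : topologicalZmodType)
  (HG : LCA_group G) (HGnd : non_discrete G)
  (V : set (dual R G)) (HVo : open V) (HV0 : V ch0)
  (HVc : compact (closure V))
  (S : set (dual R G -> CC R)) (nS : (dual R G -> CC R) -> R)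
  (HS : segal_algebra (closure V) S nS) :
  C_BSE (closure V) `<=` multipliers S /\
  (iso_translation_invariant S nS -> multipliers S = C_BSE (closure V)).
Proof.
have sub : C_BSE (closure V) `<=` multipliers S.
  move=> phi Cphi; split; first by case: Cphi.
  by move=> psi; exact: (C_BSE_multiplier HVo HV0 HVc HS).
split=> // HT; apply/seteqP; split => // phi.
exact: (multiplier_C_BSE HVo HV0 HVc HS HT).
Qed.
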